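(* Let $(G,\Omega_G)$ and $(F,\Omega_F)$ be two holomorphic IFS that satisfy the strong separation condition. Then they have the same attractor, $A_G=A_F$, if and only if $\mathbf{Prep}_G=\mathbf{Prep}_F$.
   Context: A holomorphic IFS is a pair $(G,\Omega)$ where $\Omega$ is a bounded domain in $\mathbb{C}$ and $G=\{g_i:\Omega\to\Omega\}_{i\in\Lambda}$ is a finite collection of univalent (holomorphic injective) maps with $\overline{g_i(\Omega)}\subset\Omega$ for all $i$. (Each $g_i$ is then a strict contraction of $\Omega$ in its hyperbolic metric.) Its attractor $A_G$ is the unique non-empty compact set $A\subset\Omega$ with $A=\bigcup_{i\in\Lambda}g_i(A)$; it is always assumed that $\#A_G\ge2$. The strong separation condition (SSC) means $g_i(A_G)\cap g_j(A_G)=\emptyset$ for all $i\neq j$. $\Lambda^*$ is the set of all finite words $\mathbf{w}=(i_1,\dots,i_k)$, $k\ge1$, with letters in $\Lambda$, and $g_{\mathbf{w}}=g_{i_1}\circ\dots\circ g_{i_k}:\Omega\to\Omega$. Put $$\mathbf{Per}_G=\{\beta\in\Omega: g_{\mathbf{w}}(\beta)=\beta \text{ for some }\mathbf{w}\in\Lambda^*\},$$ $$\mathbf{Prep}_G=\mathbf{Per}_G\cup\{g_{\mathbf{w}}(x):\mathbf{w}\in\Lambda^*,\ x\in\mathbf{Per}_G\}.$$ *)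

(* Defs.v *)
From HB Require Import structures.
From mathcomp Require Import all_boot all_order all_algebra.
From mathcomp Require Import all_classical all_reals all_analysis.
From mathcomp Require Import complex.

Set Implicit Arguments.
Unset Strict Implicit.
Unset Printing Implicit Defensive.

Import Order.TTheory GRing.Theory Num.Theory.
Import numFieldNormedType.Exports.

Local Open Scope classical_set_scope.
Local Open Scope ring_scope.

(* The plane as a normed module over the field R[i], so that [derivable] is
   complex differentiability; plain R[i] is a module over R in the library. *)
Notation plane R := ((R[i])%C^o).

(* The maps are total; only their restrictions to [ifs_dom] matter. *)
Record holomorphic_ifs (R : realType) := HolomorphicIFS {
  ifs_index : finType ;
  ifs_dom : set (plane R) ;
  ifs_map : ifs_index -> plane R -> plane R ;
  ifs_dom_neq0 : ifs_dom !=set0 ;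
  ifs_dom_open : open ifs_dom ;
  ifs_dom_connected : connected ifs_dom ;
  ifs_dom_bounded : bounded_set ifs_dom ;
  ifs_map_into : forall i z, ifs_dom z -> ifs_dom (ifs_map i z) ;
  ifs_map_holomorphic : forall i z, ifs_dom z -> derivable (ifs_map i) z 1 ;
  ifs_map_injective : forall i, set_inj ifs_dom (ifs_map i) ;
  ifs_map_closure : forall i, closure (ifs_map i @` ifs_dom) `<=` ifs_dom
}.

Section HolomorphicIFS.
Variables (R : realType) (G : holomorphic_ifs R).
Implicit Types (A : set (plane R)) (w : seq (ifs_index G)).

(* Existence (for a non-empty index set) and uniqueness of such a set follow
   from hyperbolic contraction; they are not part of the definition. *)
Definition is_attractor A :=
  [/\ A !=set0, compact A, A `<=` ifs_dom G
    & A = \bigcup_(i : ifs_index G) (ifs_map i @` A)].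

Definition strong_separation A :=
  forall i j : ifs_index G, i != j ->
    (ifs_map i @` A) `&` (ifs_map j @` A) = set0.

(* For w = [:: i1; ...; ik] this is g_i1 (g_i2 (... (g_ik z))). *)
Definition word_map w (z : plane R) : plane R := foldr (@ifs_map R G) z w.

Definition Per : set (plane R) :=
  [set b | ifs_dom G b /\ exists2 w, w != [::] & word_map w b = b].

Definition Prep : set (plane R) :=
  Per `|` [set y | exists w x, [/\ w != [::], Per x & y = word_map w x]].

End HolomorphicIFS.

(* Main.v *)
(** Let [A] be a common attractor and let [beta] be preperiodic for [F], so that
    [beta = f_v x] for arbitrarily long words [v]. Let [g_w A] be the smallest
    piece along the [G]-itinerary of [beta] that contains [f_v A]. By strong
    separation and bounded distortion the maps [h_v = g_w^-1 o f_v : A -> A] are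
    uniformly bi-Lipschitz and uniformly close to affine at small scales, hence
    totally bounded in a [C^1] sense; by rigidity, two of them that are close
    enough are equal. Since [h_v x] is the tail of [beta] after the word [w], an
    equality for words [w] of different lengths makes the itinerary of [beta]
    eventually periodic. Rigidity holds because a self-map of [A] close to the
    identity but different from it restricts, at the scale of its displacement,
    to an almost-translation of a piece of [A], and a bounded set cannot be
    translated into itself. For the converse, periodic points lie in the
    attractor and are dense in it.

    Of complex analysis only Goursat's theorem in log-polar coordinates is
    needed: it yields a maximum principle at the centre of a disc, and from it
    Cauchy's estimate, the Lipschitz continuity of derivatives and the
    non-vanishing of the derivative of an injective map. Contraction of the
    iterates is obtained by the method of Earle and Hamilton. *)

Require Import Defs.
From mathcomp Require Import all_boot all_order all_algebra.
From mathcomp Require Import all_classical all_reals all_analysis.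
From mathcomp Require Import complex.
From mathcomp Require Import ring lra.

Set Implicit Arguments.
Unset Strict Implicit.
Unset Printing Implicit Defensive.

Import Order.TTheory GRing.Theory Num.Theory.
Import numFieldNormedType.Exports.

Local Open Scope classical_set_scope.
Local Open Scope ring_scope.

(** The maps [h_v] have no common domain of holomorphy: the image of [ifs_dom F] under [f_v] need
    not lie in the image of [ifs_dom G] under [g_w], so [h_v] is available on [A] only and normal
    families do not apply. Beyond the geometry of a single attractor the argument therefore uses
    difference quotients at pairs of points of [A]. The condition [quasi_affine] replaces a bound on
    the second derivative: near any point, the quotients of [h_v] vary by at most a constant times
    the distance. Finitely many values then control such a map together with its quotients, which
    makes a pigeonhole argument possible. Strong separation acts at every scale through the single
    estimate [isolation]: a piece stays away from the rest of [A] by a fixed proportion of its size.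
    For [G] it makes [f_v A] and the piece [g_w A] comparable and confines a small self-map of [A]
    to a piece; for [F] it shows that a point of [A] close to [h_v A] belongs to [h_v A]. *)

Local Notation nm := ComplexField.Normc.normc.

(** * Modulus and compactness in the plane *)

Section Modulus.
Variable R : realType.
Implicit Types x y z : R[i].

(** The norm of [R[i]] is itself an element of [R[i]]; all estimates are made with the real number
    [nm x] instead. *)
Lemma normr_nm x : `|x| = ((nm x)%:C)%C.
Proof. by case: x. Qed.

Lemma nmD x y : nm (x + y) <= nm x + nm y.
Proof. by rewrite -lecR rmorphD /= -!normr_nm ler_normD. Qed.

Lemma nmN x : nm (- x) = nm x.
Proof. by apply: complexI; rewrite -!normr_nm normrN. Qed.

Lemma nmBC x y : nm (x - y) = nm (y - x).
Proof. by rewrite -nmN opprB. Qed.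

Lemma nmM x y : nm (x * y) = nm x * nm y.
Proof. exact: ComplexField.Normc.normcM. Qed.

Lemma nmV x : nm x^-1 = (nm x)^-1.
Proof. exact: ComplexField.Normc.normcV. Qed.

Lemma nm_div x y : nm (x / y) = nm x / nm y.
Proof. by rewrite nmM nmV. Qed.

Lemma nm0 : nm (0 : R[i]) = 0.
Proof. exact: ComplexField.Normc.normc0. Qed.

Lemma nm1 : nm (1 : R[i]) = 1.
Proof. exact: ComplexField.Normc.normc1. Qed.

Lemma nm_ge0 x : 0 <= nm x.
Proof. by case: x => a b; exact: sqrtr_ge0. Qed.

Lemma nm_eq0 x : (nm x == 0) = (x == 0).
Proof.
apply/eqP/eqP => [/ComplexField.Normc.eq0_normc//|->]; exact: nm0.
Qed.

Lemma nm_gt0 x : (0 < nm x) = (x != 0).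
Proof. by rewrite lt_def nm_ge0 andbT nm_eq0. Qed.

Lemma nmB_gt0 x y : x <> y -> 0 < nm (x - y).
Proof. by move=> /eqP xy; rewrite nm_gt0 subr_eq0. Qed.

Lemma nmB_eq0 x y : nm (x - y) <= 0 -> x = y.
Proof.
by move=> h; apply/eqP; rewrite -subr_eq0 -nm_eq0 eq_le h nm_ge0.
Qed.

Lemma nmB_trans y x z : nm (x - z) <= nm (x - y) + nm (y - z).
Proof. by rewrite (_ : x - z = (x - y) + (y - z)) ?nmD//; ring. Qed.

Lemma nm_leB x y : nm x <= nm y + nm (x - y).
Proof. by rewrite {1}(_ : x = y + (x - y)) ?nmD//; ring. Qed.

Lemma nm_real (a : R) : nm (a%:C)%C = `|a|.
Proof. by apply: complexI; rewrite -normr_nm normc_def /= expr0n/= addr0 sqrtr_sqr. Qed.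

Lemma nm_nat n : nm (n%:R : R[i]) = n%:R.
Proof. by rewrite -(rmorph_nat (real_complex R)) nm_real ger0_norm. Qed.

Lemma Re_le_nm x : complex.Re x <= nm x.
Proof.
case: x => a b /=; apply: le_trans (ler_norm a) _.
by rewrite -sqrtr_sqr ler_sqrt ?addr_ge0 ?sqr_ge0// lerDl sqr_ge0.
Qed.

Lemma absRe_le_nm x : `|complex.Re x| <= nm x.
Proof.
by rewrite ler_norml Re_le_nm andbT lerNl -nmN; have := Re_le_nm (- x); case: (x).
Qed.

Lemma absIm_le_nm x : `|complex.Im x| <= nm x.
Proof.
case: x => a b /=.
by rewrite -sqrtr_sqr ler_sqrt ?addr_ge0 ?sqr_ge0// lerDr sqr_ge0.
Qed.

Lemma nm_le_ReIm x : nm x <= `|complex.Re x| + `|complex.Im x|.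
Proof.
case: x => a b /=; rewrite -[leRHS]ger0_norm ?addr_ge0// -sqrtr_sqr.
rewrite ler_sqrt ?sqr_ge0// sqrrD !real_normK ?num_real//.
by rewrite lerD2r lerDl mulrn_wge0// mulr_ge0.
Qed.

Lemma nbhs_planeP (x : plane R) (P : set (plane R)) :
  nbhs x P <-> exists2 d : R, 0 < d & forall y, nm (y - x) < d -> P y.
Proof.
split.
  move=> /nbhs_ballP[e e0 h]; exists (complex.Re e).
    by move: e0; rewrite /= ltcE /= => /andP[].
  move=> y yx; apply: h; rewrite -ball_normE /= distrC normr_nm.
  by move: e0; case: e yx => a b /= yx; rewrite !ltcE /= => /andP[-> _].
move=> [d d0 h]; apply/nbhs_ballP; exists ((d%:C)%C : R[i]).
  by rewrite /= ltcR.
by move=> y; rewrite -ball_normE /= distrC normr_nm ltcR => /h.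
Qed.

(** Stands in for extrema of continuous functions: only a local bound around each point has to be
    found. Positive lower bounds are encoded as [n.+1%:R^-1], which weaken as [n] grows. *)
Lemma compact_uniform (A : set (plane R)) (P : nat -> R[i] -> Prop) :
  compact A -> (forall n m x, (n <= m)%N -> P n x -> P m x) ->
  (forall a, A a -> exists n, exists2 d : R, 0 < d &
      forall y, A y -> nm (y - a) < d -> P n y) ->
  exists n, forall y, A y -> P n y.
Proof.
move=> /compact_near_coveringP/near_covering_withinP cA mono loc.
suff /cA[n _ hn] : forall x : plane R, A x ->
    \forall x' \near x & i \near \oo, A x' -> P i x'.
  by exists n => y Ay; apply: (hn n) => //=.
move=> x Ax; have [n [d d0 h]] := loc x Ax.
exists ([set y | nm (y - x) < d], [set m | (n <= m)%N]) => /=.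
  split; last by exists n.
  by apply/nbhs_planeP; exists d.
by move=> [y m] /= [yd nm'] Ay; apply: mono nm' _; exact: h.
Qed.

Lemma bounded_closed_compact_plane (A : set (plane R)) (M : R) :
  closed A -> (forall x, A x -> nm x <= M) -> compact A.
Proof.
move=> clA bA.
pose f (p : R * R) : plane R := (p.1 +i* p.2)%C.
apply: (@subclosed_compact _ A (f @` (`[- M, M] `*` `[- M, M]))) => //.
  apply: continuous_compact; last by apply: compact_setX; exact: segment_compact.
  apply: continuous_subspaceT => p U /nbhs_planeP[d d0 hU].
  exists (ball p.1 (d / 2), ball p.2 (d / 2)) => /=.
    by split; apply: nbhsx_ballx; rewrite divr_gt0.
  move=> [a b] /= []; rewrite -!ball_normE /= => h1 h2; apply: hU.
  apply: le_lt_trans (nm_le_ReIm _) _; rewrite /f /=.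
  by rewrite (splitr d) ltrD// distrC.
move=> x Ax; have nx := bA x Ax; exists (complex.Re x, complex.Im x).
  split; rewrite /= in_itv /= -ler_norml.
    exact: le_trans (absRe_le_nm x) nx.
  exact: le_trans (absIm_le_nm x) nx.
by rewrite /f; case: (x).
Qed.

Lemma closureP_plane (A : set (plane R)) x :
  closure A x <-> forall d, 0 < d -> exists2 y, A y & nm (y - x) < d.
Proof.
split=> [cx d d0|h U /nbhs_planeP[d d0 hU]].
  have [|y [Ay /= yd]] := cx [set y | nm (y - x) < d].
    by apply/nbhs_planeP; exists d.
  by exists y.
by have [y Ay yd] := h d d0; exists y; split => //; apply: hU.
Qed.

Lemma compact_closedP (A : set (plane R)) x : compact A ->
  (forall d, 0 < d -> exists2 y, A y & nm (y - x) < d) -> A x.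
Proof.
move=> cA h.
have : closed A by apply: compact_closed => //; exact: norm_hausdorff.
by apply; apply/closureP_plane.
Qed.

Lemma compact_bounded_nm (A : set (plane R)) : compact A ->
  exists2 M, 0 < M & forall x, A x -> nm x <= M.
Proof.
move=> cA; have [|a Aa|n hn] := @compact_uniform A (fun n x => nm x <= n%:R) cA.
- by move=> n m x nm' /le_trans; apply; rewrite ler_nat.
- have [n hn] : exists n : nat, nm a + 1 <= n%:R.
    exists (Num.truncn (nm a + 1)).+1.
    by apply: ltW; apply: truncnS_gt.
  exists n; exists 1 => // y _ ya; apply: le_trans (nm_leB y a) _.
  by apply: le_trans hn; rewrite lerD2l ltW.
by exists n.+1%:R => // x /hn /le_trans; apply; rewrite ler_nat.
Qed.

End Modulus.

(** * Goursat's theorem *)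

Section IntervalIntegral.
Variable R : realType.
Implicit Types (f g : R -> R) (a b c m : R).

Definition itv_int f a b : R := \int[lebesgue_measure]_(x in `[a, b]) f x.

Definition cont_on f a b := forall x : R, a <= x <= b -> {for x, continuous f}.

Lemma cont_onB f g a b :
  cont_on f a b -> cont_on g a b -> cont_on (fun x => f x - g x) a b.
Proof.
move=> fc gc x xab.
exact: (@continuousB _ R^o R (f : R -> R^o) g x (fc x xab) (gc x xab)).
Qed.

Lemma cont_integrable f a b : cont_on f a b ->
  lebesgue_measure.-integrable `[a, b] (EFin \o f).
Proof.
move=> fc; apply: continuous_compact_integrable; first exact: segment_compact.
apply: continuous_in_subspaceT => x /set_mem /=; rewrite in_itv /=; exact: fc.
Qed.

Lemma itv_intB f g a b : cont_on f a b -> cont_on g a b ->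
  itv_int (fun x => f x - g x) a b = itv_int f a b - itv_int g a b.
Proof. by move=> fc gc; rewrite /itv_int RintegralB//; exact: cont_integrable. Qed.

Lemma itv_int_cat f a c b : a <= c -> c <= b -> cont_on f a b ->
  itv_int f a b = itv_int f a c + itv_int f c b.
Proof.
move=> ac cb fc; have fi := cont_integrable fc.
have := @Rintegral_itvB R f (BLeft a) (BRight b) c fi.
rewrite !bnd_simp => /(_ ac cb) /eqP; rewrite subr_eq addrC => /eqP.
rewrite Rintegral_itv_obnd_cbnd//.
by apply: integrableS fi => //; apply: subset_itv; rewrite bnd_simp.
Qed.

Lemma itv_int_cst m a b : a <= b -> itv_int (fun=> m) a b = m * (b - a).
Proof.
move=> ab; rewrite /itv_int Rintegral_cst//= lebesgue_measure_itv /= lte_fin.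
by case: ltP => //= ba; rewrite (@le_anti _ _ a b) ?subrr ?mulr0 ?ab.
Qed.

Lemma itv_int_le f m a b : a <= b -> cont_on f a b ->
  (forall x, a <= x <= b -> f x <= m) -> itv_int f a b <= m * (b - a).
Proof.
move=> ab fc h; rewrite -itv_int_cst//; apply: le_Rintegral => //.
- exact: cont_integrable.
- by apply: cont_integrable => x _; exact: cst_continuous.
Qed.

Lemma itv_int_ge f m a b : a <= b -> cont_on f a b ->
  (forall x, a <= x <= b -> m <= f x) -> m * (b - a) <= itv_int f a b.
Proof.
move=> ab fc h; rewrite -itv_int_cst//; apply: le_Rintegral => //.
- by apply: cont_integrable => x _; exact: cst_continuous.
- exact: cont_integrable.
Qed.

Lemma itv_int_approx f m e a b : a <= b -> cont_on f a b ->
  (forall x, a <= x <= b -> `|f x - m| <= e) ->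
  `|itv_int f a b - m * (b - a)| <= e * (b - a).
Proof.
move=> ab fc h.
have h1 : itv_int f a b <= (m + e) * (b - a).
  by apply: itv_int_le => // x /h; rewrite ler_norml => /andP[]; lra.
have h2 : (m - e) * (b - a) <= itv_int f a b.
  by apply: itv_int_ge => // x /h; rewrite ler_norml => /andP[]; lra.
by rewrite ler_norml; apply/andP; split; lra.
Qed.

End IntervalIntegral.

Section Goursat.
Variable R : realType.
Implicit Types (P Q : R -> R -> R).

Definition has_diff2 P (s t p p' : R) := forall e, 0 < e ->
  exists2 d : R, 0 < d & forall h k, `|h| < d -> `|k| < d ->
    `|P (s + h) (t + k) - P s t - (p * h + p' * k)| <= e * (`|h| + `|k|).

Lemma has_diff2_cont P s t p p' : has_diff2 P s t p p' ->
  {for t, continuous (P s)} /\ {for s, continuous (P ^~ t)}.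
Proof.
move=> /(_ 1 ltr01)[d d0 h].
split; apply/cvgrPdist_le => /= e e0.
  near=> x.
  have := h 0 (x - t); rewrite normr0 addr0 (addrC t) subrK mulr0 !add0r mul1r.
  have xd : `|x - t| < d.
    by rewrite distrC; near: x; apply: cvgr_dist_lt => //; exact: cvg_id.
  move=> /(_ d0 xd) hx.
  have xe : `|x - t| * (1 + `|p'|) <= e.
    rewrite -ler_pdivlMr ?ltr_wpDr// distrC.
    by near: x; apply: cvgr_dist_le; [exact: cvg_id|rewrite divr_gt0 ?ltr_wpDr].
  rewrite distrC; apply: le_trans xe.
  rewrite mulrDr mulr1 -normrM mulrC.
  rewrite (_ : P s x - P s t = (P s x - P s t - p' * (x - t)) + p' * (x - t)).
    by apply: le_trans (ler_normD _ _) _; rewrite lerD2r.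
  by ring.
near=> x.
have := h (x - s) 0; rewrite normr0 addr0 (addrC s) subrK mulr0 !addr0 mul1r.
have xd : `|x - s| < d.
  by rewrite distrC; near: x; apply: cvgr_dist_lt => //; exact: cvg_id.
move=> /(_ xd d0) hx.
have xe : `|x - s| * (1 + `|p|) <= e.
  rewrite -ler_pdivlMr ?ltr_wpDr// distrC.
  by near: x; apply: cvgr_dist_le; [exact: cvg_id|rewrite divr_gt0 ?ltr_wpDr].
rewrite distrC; apply: le_trans xe.
rewrite mulrDr mulr1 -normrM mulrC.
rewrite (_ : P x t - P s t = (P x t - P s t - p * (x - s)) + p * (x - s)).
  by apply: le_trans (ler_normD _ _) _; rewrite lerD2r.
by ring.
Unshelve. all: by end_near. Qed.

(** The outward flux of the field [(P, Q)] through the boundary of a rectangle. For [P = Re F] and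
    [Q = - Im F] it is the imaginary part of the contour integral of [F], and the condition
    [p + q' = 0] of [goursat], vanishing divergence, is one of the Cauchy-Riemann equations. *)
Definition flux P Q (a h c k : R) : R :=
  itv_int (fun t => P (a + h) t - P a t) c (c + k) +
  itv_int (fun s => Q s (c + k) - Q s c) a (a + h).

Definition sep_cont P Q (a h c k : R) := forall s t,
  a <= s <= a + h -> c <= t <= c + k ->
  {for t, continuous (P s)} /\ {for s, continuous (Q ^~ t)}.

Lemma sep_contP P Q (a h c k s a' b' : R) : sep_cont P Q a h c k ->
  a <= s <= a + h -> c <= a' -> b' <= c + k -> cont_on (P s) a' b'.
Proof.
move=> H sab ca bc x /andP[ax xb]; have [] // := H s x sab.
by rewrite (le_trans ca)//= (le_trans xb).
Qed.

Lemma sep_contQ P Q (a h c k t a' b' : R) : sep_cont P Q a h c k ->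
  c <= t <= c + k -> a <= a' -> b' <= a + h -> cont_on (Q ^~ t) a' b'.
Proof.
move=> H tab ca bc x /andP[ax xb]; have [] // := H x t _ tab.
by rewrite (le_trans ca)//= (le_trans xb).
Qed.

Lemma flux_quarter P Q (a h c k : R) : 0 <= h -> 0 <= k ->
  sep_cont P Q a (2 * h) c (2 * k) ->
  flux P Q a (2 * h) c (2 * k) =
    flux P Q a h c k + flux P Q (a + h) h c k +
    (flux P Q a h (c + k) k + flux P Q (a + h) h (c + k) k).
Proof.
move=> h0 k0 H; rewrite /flux.
have e1 : a + 2 * h = a + h + h by ring.
have e2 : c + 2 * k = c + k + k by ring.
have cP s a' b' : a <= s -> s <= a + h + h -> c <= a' -> b' <= c + k + k ->
    cont_on (P s) a' b'.
  by rewrite -e1 -e2 => x1 x2 x3 x4; apply: (sep_contP H) => //; rewrite x1.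
have cQ t a' b' : c <= t -> t <= c + k + k -> a <= a' -> b' <= a + h + h ->
    cont_on (Q ^~ t) a' b'.
  by rewrite -e1 -e2 => x1 x2 x3 x4; apply: (sep_contQ H) => //; rewrite x1.
rewrite e1 e2 (@itv_int_cat _ _ c (c + k)) ?lerDl//; last first.
  by apply: cont_onB; apply: cP; lra.
rewrite (@itv_int_cat _ _ a (a + h)) ?lerDl//; last first.
  by apply: cont_onB; apply: cQ; lra.
do ![rewrite itv_intB; [|solve [apply: cP; lra | apply: cQ; lra]..]].
by ring.
Qed.

(** The affine parts contribute [(p + q') h k = 0]; differentiability bounds each remaining
    integrand by [e (h + k)]. *)
Lemma flux_local P Q (s t p p' q q' : R) : p + q' = 0 ->
  has_diff2 P s t p p' -> has_diff2 Q s t q q' ->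
  forall e, 0 < e -> exists2 d : R, 0 < d & forall a h c k,
    0 < h < d -> 0 < k < d -> a <= s <= a + h -> c <= t <= c + k ->
    sep_cont P Q a h c k -> `|flux P Q a h c k| <= e * (h + k) ^+ 2.
Proof.
move=> pq hP hQ e e0.
(* Each integrand is a difference of two values, and each value costs [e / 2]. *)
have e20 : 0 < e / 2 by rewrite divr_gt0.
have [d1 d10 {}hP] := hP _ e20; have [d2 d20 {}hQ] := hQ _ e20.
exists (Num.min d1 d2); first by rewrite lt_min d10.
move=> a h c k /andP[h0]; rewrite lt_min => /andP[h1 h2] /andP[k0].
rewrite lt_min => /andP[k1 k2] /andP[as_ sa] /andP[ct tc] H.
have est (F : R -> R -> R) (d u u' : R) : h < d -> k < d ->
    (forall h k, `|h| < d -> `|k| < d ->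
      `|F (s + h) (t + k) - F s t - (u * h + u' * k)| <= e / 2 * (`|h| + `|k|)) ->
    forall x y, a <= x <= a + h -> c <= y <= c + k ->
    `|F x y - F s t - (u * (x - s) + u' * (y - t))| <= e / 2 * (h + k).
  move=> hd kd hF x y /andP[x1 x2] /andP[y1 y2].
  have xs : `|x - s| <= h by rewrite ler_norml; apply/andP; split; lra.
  have yt : `|y - t| <= k by rewrite ler_norml; apply/andP; split; lra.
  have := hF (x - s) (y - t) (le_lt_trans xs hd) (le_lt_trans yt kd).
  rewrite ![_ + (_ - _)]addrC !subrK => /le_trans; apply.
  by rewrite ler_pM2l// lerD.
have eP := est P d1 p p' h1 k1 hP; have eQ := est Q d2 q q' h2 k2 hQ.
have i1 : `|itv_int (fun t => P (a + h) t - P a t) c (c + k) - (p * h) * k| <= e * (h + k) * k.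
  have -> : e * (h + k) * k = e * (h + k) * ((c + k) - c) by ring.
  have -> : p * h * k = p * h * ((c + k) - c) by ring.
  apply: itv_int_approx; first by lra.
    by apply: cont_onB; apply: (sep_contP H) => //; lra.
  move=> y yc; have := eP (a + h) y; have := eP a y.
  have -> : a <= a <= a + h by lra.
  have -> : a <= a + h <= a + h by lra.
  move=> /(_ isT yc) X1 /(_ isT yc) X2.
  have := ler_normB (P (a + h) y - P s t - (p * (a + h - s) + p' * (y - t)))
     (P a y - P s t - (p * (a - s) + p' * (y - t))).
  rewrite (_ : _ - _ = P (a + h) y - P a y - p * h); last by ring.
  by move=> X; lra.
have i2 : `|itv_int (fun s => Q s (c + k) - Q s c) a (a + h) - (q' * k) * h| <= e * (h + k) * h.
  have -> : e * (h + k) * h = e * (h + k) * ((a + h) - a) by ring.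
  have -> : q' * k * h = q' * k * ((a + h) - a) by ring.
  apply: itv_int_approx; first by lra.
    by apply: cont_onB; apply: (sep_contQ H) => //; lra.
  move=> x xc; have := eQ x (c + k); have := eQ x c.
  have -> : c <= c <= c + k by lra.
  have -> : c <= c + k <= c + k by lra.
  move=> /(_ xc isT) X1 /(_ xc isT) X2.
  have := ler_normB (Q x (c + k) - Q s t - (q * (x - s) + q' * (c + k - t)))
     (Q x c - Q s t - (q * (x - s) + q' * (c - t))).
  rewrite (_ : _ - _ = Q x (c + k) - Q x c - q' * k); last by ring.
  by move=> X; lra.
rewrite /flux.
move: i1 i2; set I1 := itv_int _ _ _; set I2 := itv_int _ _ _ => i1 i2.
rewrite (_ : I1 + I2 = (I1 - p * h * k) + (I2 - q' * k * h)); last first.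
  by rewrite (_ : q' = - p) ; [ring|lra].
apply: le_trans (ler_normD _ _) _.
rewrite (_ : e * (h + k) ^+ 2 = e * (h + k) * k + e * (h + k) * h); last by ring.
exact: lerD.
Qed.

Lemma half_step (x x' a b w : R) : 0 < w -> x' = x \/ x' = x + w ->
  a <= x -> x + 2 * w <= b ->
  [/\ a <= x', x' + w <= b, x <= x' & x' + w <= x + 2 * w].
Proof. by move=> w0 [->|->] h1 h2; split; lra. Qed.

Lemma goursat P Q (a w c v : R) : 0 < w -> 0 < v ->
  (forall s t, a <= s <= a + w -> c <= t <= c + v ->
     exists p p' q q', [/\ p + q' = 0, has_diff2 P s t p p' & has_diff2 Q s t q q']) ->
  flux P Q a w c v = 0.
Proof.
move=> w0 v0 H.
have SC : sep_cont P Q a w c v.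
  move=> s t sa tc; have [p [p' [q [q' [_ hP hQ]]]]] := H s t sa tc.
  by have [? _] := has_diff2_cont hP; have [_ ?] := has_diff2_cont hQ.
apply/eqP/negPn/negP => F0.
pose wn n := w / 2 ^+ n; pose vn n := v / 2 ^+ n.
have p2 n : 0 < (2 : R) ^+ n by rewrite exprn_gt0.
have w2 n : wn n = 2 * wn n.+1.
  by rewrite /wn exprS; field; rewrite gt_eqF.
have v2 n : vn n = 2 * vn n.+1.
  by rewrite /vn exprS; field; rewrite gt_eqF.
have wn0 n : 0 < wn n by rewrite divr_gt0.
have vn0 n : 0 < vn n by rewrite divr_gt0.
pose g : R := `|flux P Q a w c v|.
have g0 : 0 < g by rewrite normr_gt0.
pose inr (p : R * R) n := [/\ a <= p.1, p.1 + wn n <= a + w, c <= p.2 & p.2 + vn n <= c + v].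
pose bad n (p : R * R) := inr p n /\ g / 4 ^+ n <= `|flux P Q p.1 (wn n) p.2 (vn n)|.
pose nxt n (p p' : R * R) := [/\ p.1 <= p'.1, p'.1 + wn n.+1 <= p.1 + wn n,
   p.2 <= p'.2 & p'.2 + vn n.+1 <= p.2 + vn n].
have SCs n p : inr p n -> sep_cont P Q p.1 (wn n) p.2 (vn n).
  move=> [x1 x2 x3 x4] s t /andP[? ?] /andP[? ?].
  by apply: SC; apply/andP; split; lra.
(* The implication sits under the existential so that [choice] returns a total map, which can be
   iterated. *)
have step (np : nat * (R * R)) : exists p', bad np.1 np.2 -> bad np.1.+1 p' /\ nxt np.1 np.2 p'.
  case: np => n p /=.
  have [[ip bp]|nb] := pselect (bad n p); last by exists p => /nb.
  have w0' := wn0 n.+1; have v0' := vn0 n.+1; have := SCs n p ip.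
  move=> sc; rewrite (w2 n) (v2 n) in bp sc.
  case: ip => x1; rewrite (w2 n) => x2 x3; rewrite (v2 n) => x4.
  have q4 := flux_quarter (ltW w0') (ltW v0') sc.
  have g4 : g / 4 ^+ n = 4 * (g / 4 ^+ n.+1).
    by rewrite exprS; field; rewrite gt_eqF// exprn_gt0.
  have ok p' : (p'.1 = p.1 \/ p'.1 = p.1 + wn n.+1) -> (p'.2 = p.2 \/ p'.2 = p.2 + vn n.+1) ->
     g / 4 ^+ n.+1 <= `|flux P Q p'.1 (wn n.+1) p'.2 (vn n.+1)| ->
     bad n.+1 p' /\ nxt n p p'.
    move=> o1 o2 o3; have [y1 y2 y3 y4] := half_step w0' o1 x1 x2.
    have [y5 y6 y7 y8] := half_step v0' o2 x3 x4.
    by split; [split|rewrite /nxt (w2 n) (v2 n)].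
  set F0' := flux _ _ _ _ _ _ in q4; set F1 := flux _ _ _ _ _ _ in q4; set F2 := flux _ _ _ _ _ _ in q4.
  set F3 := flux _ _ _ _ _ _ in q4; set F4 := flux _ _ _ _ _ _ in q4.
  have : `|F1 + F2 + (F3 + F4)| <= `|F1| + `|F2| + (`|F3| + `|F4|).
    apply: le_trans (ler_normD _ _) _; apply: lerD; exact: ler_normD.
  move: bp; rewrite -/F0' q4 g4 => bp ble.
  have [z1|z1] := lerP (g / 4 ^+ n.+1) `|F1|; first by exists p => _; apply: ok; [by left|by left|exact: z1].
  have [z2|z2] := lerP (g / 4 ^+ n.+1) `|F2|.
    by exists (p.1 + wn n.+1, p.2) => _; apply: ok; [by right|by left|exact: z2].
  have [z3|z3] := lerP (g / 4 ^+ n.+1) `|F3|.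
    by exists (p.1, p.2 + vn n.+1) => _; apply: ok; [by left|by right|exact: z3].
  have [z4|z4] := lerP (g / 4 ^+ n.+1) `|F4|.
    by exists (p.1 + wn n.+1, p.2 + vn n.+1) => _; apply: ok; [by right|by right|exact: z4].
  lra.
have [f fP] := choice step.
pose X n := iteri n (fun k p => f (k, p)) (a, c).
have wn_0 : wn 0 = w by rewrite /wn expr0 divr1.
have vn_0 : vn 0 = v by rewrite /vn expr0 divr1.
have bX n : bad n (X n).
  elim: n => [|n IH]; last by have [] := fP (n, X n) IH.
  by split; [split; rewrite /= ?wn_0 ?vn_0|rewrite /= wn_0 vn_0 expr0 divr1].
have nX n : nxt n (X n) (X n.+1) by have [] := fP (n, X n) (bX n).
have nXm n m : [/\ (X n).1 <= (X (n + m)%N).1, (X (n + m)%N).1 + wn (n + m)%N <= (X n).1 + wn n,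
   (X n).2 <= (X (n + m)%N).2 & (X (n + m)%N).2 + vn (n + m)%N <= (X n).2 + vn n].
  elim: m => [|m [x1 x2 x3 x4]]; first by rewrite addn0; split.
  rewrite addnS; have [y1 y2 y3 y4] := nX (n + m)%N; split; lra.
have X1 n m : (X m).1 <= (X n).1 + wn n.
  have [mn|/ltnW mn] := leqP m n.
    have [x1 _ _ _] := nXm m (n - m)%N; rewrite subnKC// in x1.
    by have := wn0 n; lra.
  have [_ x2 _ _] := nXm n (m - n)%N; rewrite subnKC// in x2.
  by have := wn0 m; lra.
have X2 n m : (X m).2 <= (X n).2 + vn n.
  have [mn|/ltnW mn] := leqP m n.
    have [_ _ x1 _] := nXm m (n - m)%N; rewrite subnKC// in x1.
    by have := vn0 n; lra.
  have [_ _ _ x2] := nXm n (m - n)%N; rewrite subnKC// in x2.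
  by have := vn0 m; lra.
pose s := sup (range (fun n => (X n).1)); pose t := sup (range (fun n => (X n).2)).
have sP n : (X n).1 <= s <= (X n).1 + wn n.
  apply/andP; split.
    apply: sup_upper_bound; last by exists n.
    by split; [exists (X 0).1, 0%N|exists ((X 0).1 + wn 0) => _ [m _ <-]; exact: X1].
  by apply: ge_sup; [exists (X 0).1, 0%N|move=> _ [m _ <-]; exact: X1].
have tP n : (X n).2 <= t <= (X n).2 + vn n.
  apply/andP; split.
    apply: sup_upper_bound; last by exists n.
    by split; [exists (X 0).2, 0%N|exists ((X 0).2 + vn 0) => _ [m _ <-]; exact: X2].
  by apply: ge_sup; [exists (X 0).2, 0%N|move=> _ [m _ <-]; exact: X2].
have := sP 0%N; have := tP 0%N; rewrite /= wn_0 vn_0 => t0 s0.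
have [p [p' [q [q' [pq hP hQ]]]]] := H s t s0 t0.
(* With this [e] the local estimate at level [n] is [g / 4 ^+ n / 2], half of the flux that survives
   there. *)
have e0 : 0 < g / (2 * (w + v) ^+ 2).
  by rewrite divr_gt0// mulr_gt0// exprn_gt0// addr_gt0.
have [d d0 hd] := flux_local pq hP hQ e0.
have [n nd] : exists n : nat, (w + v) / d < n%:R.
  by exists (Num.truncn ((w + v) / d)).+1; exact: truncnS_gt.
have n2 : (w + v) / d < 2 ^+ n.
  by apply: lt_trans nd _; rewrite -natrX ltr_nat ltn_expl.
have wvd : wn n + vn n < d.
  by rewrite /wn /vn -mulrDl ltr_pdivrMr// mulrC -ltr_pdivrMr.
have [ip bp] := bX n.
have := hd (X n).1 (wn n) (X n).2 (vn n) _ _ (sP n) (tP n) (SCs _ _ ip).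
have wv1 : 0 < wn n < d by rewrite wn0 /=; have := vn0 n; lra.
have wv2 : 0 < vn n < d by rewrite vn0 /=; have := wn0 n; lra.
move=> /(_ wv1 wv2) /(le_trans bp).
have -> : g / (2 * (w + v) ^+ 2) * (wn n + vn n) ^+ 2 = g / 4 ^+ n / 2.
  have -> : 4 ^+ n = (2 ^+ n) ^+ 2 :> R.
    by rewrite exprAC; congr (_ ^+ _); rewrite -natrX.
  rewrite /wn /vn; move: (p2 n); move: (2 ^+ n : R) => z z0.
  have wv : w + v != 0 by rewrite gt_eqF// addr_gt0.
  clearbody g; clear -z0 wv.
  by field; rewrite wv gt_eqF.
have : 0 < g / 4 ^+ n by rewrite divr_gt0// exprn_gt0.
by move=> gt0; rewrite leNgt ltr_pdivrMr// mulr_natr mulr2n ltrDl gt0.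
Qed.

End Goursat.

(** * Complex differentiability *)

Section RealDerivative.
Variable R : realType.

Definition has_diff (f : R -> R) (x d : R) := forall e : R, 0 < e ->
  exists2 r : R, 0 < r & forall h, `|h| < r -> `|f (x + h) - f x - d * h| <= e * `|h|.

Lemma is_derive_has_diff (f : R -> R) (x d : R) : is_derive x 1 f d -> has_diff f x d.
Proof.
move=> [df vf] e e0.
have : (fun h => h^-1 *: ((f \o shift x) (h *: 1) - f x)) @ 0^' --> d.
  by rewrite -vf; exact: df.
move=> /cvgrPdist_le/(_ e e0); rewrite near_withinE => /nbhs_ballP[r /= r0 hr].
exists r => // h hr'; have [->|h0] := eqVneq h 0.
  by rewrite addr0 subrr mulr0 subr0 normr0 mulr0.
have := hr h; rewrite -ball_normE /= sub0r normrN => /(_ hr' h0).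
rewrite /= /GRing.scale /= mulr1 (addrC h) distrC => le_e.
rewrite -ler_pdivrMr ?normr_gt0// -normfV -normrM mulrBl mulfK//.
by rewrite mulrC.
Qed.

Lemma has_diff_is_derive (f : R -> R) (x d : R) : has_diff f x d -> is_derive x 1 f d.
Proof.
move=> hf.
have cf : (fun h => h^-1 *: ((f \o shift x) (h *: 1) - f x)) @ 0^' --> d.
  apply/cvgrPdist_le => e e0; rewrite near_withinE; apply/nbhs_ballP.
  have [r r0 hr] := hf e e0; exists r => // h; rewrite -ball_normE /= sub0r normrN.
  move=> /hr; rewrite /= /GRing.scale /= mulr1 (addrC x) => le_e h0.
  rewrite distrC -(@ler_pM2r _ `|h|) ?normr_gt0// -normrM mulrBl mulrAC mulVf//.
  by rewrite mul1r.
by split; [apply/cvg_ex; exists d|apply: cvg_lim => //; exact: norm_hausdorff].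
Qed.

End RealDerivative.

Section ComplexDerivative.
Variable R : realType.
Local Notation C := (R[i]).
Implicit Types (q f g : C -> C) (z d l : C).

(* Not a punctured limit: [lim0 q l] forces [q 0 = l]. *)
Definition lim0 q l := forall e : R, 0 < e ->
  exists2 r : R, 0 < r & forall h, nm h < r -> nm (q h - l) <= e.

Lemma lim0_cst l : lim0 (fun=> l) l.
Proof. by move=> e e0; exists 1 => // h _; rewrite subrr nm0 ltW. Qed.

Lemma lim0_id : lim0 id 0.
Proof. by move=> e e0; exists e => // h; rewrite subr0 => /ltW. Qed.

Lemma lim0D q q' l l' : lim0 q l -> lim0 q' l' -> lim0 (fun h => q h + q' h) (l + l').
Proof.
move=> hq hq' e e0; have e2 : 0 < e / 2 by rewrite divr_gt0.
have [r r0 h] := hq _ e2; have [r' r0' h'] := hq' _ e2.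
exists (Num.min r r') => [|x]; rewrite lt_min ?r0// => /andP[/h a /h' b].
rewrite (_ : q x + _ - _ = (q x - l) + (q' x - l')); last by ring.
by apply: le_trans (nmD _ _) _; lra.
Qed.

Lemma lim0M q q' l l' : lim0 q l -> lim0 q' l' -> lim0 (fun h => q h * q' h) (l * l').
Proof.
move=> hq hq' e e0.
have k0 : 0 < nm l + nm l' + 1 by rewrite ltr_wpDl// addr_ge0// nm_ge0.
pose e' := Num.min 1 (e / (nm l + nm l' + 1)).
have e1 : 0 < e' by rewrite lt_min ltr01 divr_gt0.
have [r r0 h] := hq _ e1; have [r' r0' h'] := hq' _ e1.
exists (Num.min r r') => [|x]; rewrite lt_min ?r0// => /andP[/h a /h' b].
rewrite (_ : q x * _ - _ = (q x - l) * (q' x - l') + l * (q' x - l') + (q x - l) * l'); last by ring.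
apply: le_trans (nmD _ _) _; apply: le_trans (lerD (nmD _ _) (lexx _)) _.
rewrite !nmM.
have : e' * (nm l + nm l' + 1) <= e by rewrite -ler_pdivlMr// ge_min lexx orbT.
have e'1 : e' <= 1 by rewrite ge_min lexx.
have x1 : nm (q x - l) * nm (q' x - l') <= e' * 1.
  by apply: ler_pM; rewrite ?nm_ge0// (le_trans b).
have x2 : nm l * nm (q' x - l') <= nm l * e' by rewrite ler_wpM2l// nm_ge0.
have x3 : nm (q x - l) * nm l' <= e' * nm l' by rewrite ler_wpM2r// nm_ge0.
by move=> x4; lra.
Qed.

Lemma lim0_near0 q l : lim0 q l -> l != 0 ->
  exists2 r : R, 0 < r & forall h, nm h < r -> nm l / 2 <= nm (q h).
Proof.
rewrite -nm_gt0 => hq l0; have e2 : 0 < nm l / 2 by rewrite divr_gt0.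
have [r r0 h] := hq _ e2; exists r => // x /h; rewrite nmBC => a.
by have := nm_leB l (q x); lra.
Qed.

Lemma lim0V q l : l != 0 -> lim0 q l -> lim0 (fun h => (q h)^-1) l^-1.
Proof.
move=> l0 hq; have [r r0 h] := lim0_near0 hq l0; have nl0 := l0; rewrite -nm_gt0 in nl0.
move=> e e0; have e0' : 0 < e * (nm l ^+ 2 / 2) by rewrite mulr_gt0// divr_gt0// exprn_gt0.
have [r' r0' h'] := hq _ e0'.
exists (Num.min r r') => [|x]; first by rewrite lt_min r0.
rewrite lt_min => /andP[/h a /h' b].
have qx0 : 0 < nm (q x) by rewrite (lt_le_trans _ a)// divr_gt0.
have qx : q x != 0 by rewrite -nm_gt0.
rewrite (_ : _ - _ = - ((q x - l) / (q x * l))); last by field; rewrite qx l0.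
rewrite nmN nm_div nmM ler_pdivrMr ?mulr_gt0//; apply: le_trans b _.
rewrite ler_pM2l// expr2 mulrAC; apply: ler_wpM2r => //; exact: ltW.
Qed.

Lemma lim0_comp q l k : lim0 k 0 -> lim0 q l -> lim0 (fun h => q (k h)) l.
Proof.
move=> hk hq e e0; have [r r0 h] := hq _ e0.
have [r' r0' h'] := hk (r / 2) (divr_gt0 r0 (ltr0Sn _ _)).
exists r' => // x /h'; rewrite subr0 => a; apply: h; lra.
Qed.

Lemma lim0_near q q' l (r : R) : 0 < r -> (forall h, nm h < r -> q h = q' h) ->
  lim0 q l -> lim0 q' l.
Proof.
move=> r0 qq hq e e0; have [r' r0' h] := hq _ e0.
exists (Num.min r r') => [|x]; first by rewrite lt_min r0.
by rewrite lt_min => /andP[/qq <- /h].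
Qed.

(* Caratheodory's form of differentiability. *)
Definition cderiv f z d := exists q, exists2 r : R, 0 < r &
  (forall h, nm h < r -> f (z + h) = f z + q h * h) /\ lim0 q d.

Lemma cderivP f z d :
  (forall e : R, 0 < e -> exists2 r : R, 0 < r &
    forall h, h != 0 -> nm h < r -> nm ((f (z + h) - f z) / h - d) <= e) ->
  cderiv f z d.
Proof.
(* The value [d] at [0] is forced, because [lim0] is not punctured. *)
move=> H; exists (fun h => if h == 0 then d else (f (z + h) - f z) / h); exists 1 => //.
split=> [h _|e e0].
  case: eqP => [->|/eqP h0]; first by rewrite addr0 mulr0 addr0.
  by rewrite divfK//; ring.
have [r r0 h] := H e e0; exists r => // x xr.
by case: eqP => [_|/eqP x0]; [rewrite subrr nm0 ltW|exact: h].
Qed.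

Lemma cderiv_approx f z d : cderiv f z d -> forall e : R, 0 < e ->
  exists2 r : R, 0 < r & forall h, nm h < r ->
  nm (f (z + h) - f z - d * h) <= e * nm h.
Proof.
move=> [q [r r0 [fq qd]]] e e0; have [r' r0' h] := qd e e0.
exists (Num.min r r') => [|x]; first by rewrite lt_min r0.
rewrite lt_min => /andP[/fq -> /h a].
rewrite (_ : _ - _ - _ = (q x - d) * x); last by ring.
by rewrite nmM ler_wpM2r// nm_ge0.
Qed.

Lemma cderiv_lim f z d : cderiv f z d -> lim0 (fun h => f (z + h)) (f z).
Proof.
move=> [q [r r0 [fq qd]]].
apply: (@lim0_near (fun h => f z + q h * h) _ _ r) => // [h /fq ->//|].
have := lim0D (lim0_cst (f z)) (lim0M qd lim0_id).
by rewrite mulr0 addr0.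
Qed.

Lemma cderiv_cst c z : cderiv (fun=> c) z 0.
Proof.
exists (fun=> 0), 1 => //; split; last exact: lim0_cst.
by move=> h _; rewrite mul0r addr0.
Qed.

Lemma cderiv_id z : cderiv id z 1.
Proof.
exists (fun=> 1), 1 => //; split; last exact: lim0_cst.
by move=> h _; rewrite mul1r.
Qed.

Lemma cderivD f g z d d' : cderiv f z d -> cderiv g z d' ->
  cderiv (fun x => f x + g x) z (d + d').
Proof.
move=> [q [r r0 [fq qd]]] [q' [r' r0' [fq' qd']]].
exists (fun h => q h + q' h), (Num.min r r'); first by rewrite lt_min r0.
split; last exact: lim0D.
by move=> h; rewrite lt_min => /andP[/fq -> /fq' ->]; ring.
Qed.

Lemma cderivM f g z d d' : cderiv f z d -> cderiv g z d' ->
  cderiv (fun x => f x * g x) z (d * g z + f z * d').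
Proof.
move=> fd gd; have gl := cderiv_lim gd.
move: fd gd => [q [r r0 [fq qd]]] [q' [r' r0' [fq' qd']]].
exists (fun h => q h * g (z + h) + f z * q' h), (Num.min r r'); first by rewrite lt_min r0.
split; last by apply: lim0D; apply: lim0M => //; exact: lim0_cst.
by move=> h; rewrite lt_min => /andP[/fq -> /fq' ->]; ring.
Qed.

Lemma cderiv_comp f g z d d' : cderiv f (g z) d -> cderiv g z d' ->
  cderiv (fun x => f (g x)) z (d * d').
Proof.
move=> [q [r r0 [fq qd]]] [q' [r' r0' [fq' qd']]].
have k0 : lim0 (fun h => q' h * h) 0.
  by have := lim0M qd' lim0_id; rewrite mulr0.
have [s s0 hs] := k0 (r / 2) (divr_gt0 r0 (ltr0Sn _ _)).
exists (fun h => q (q' h * h) * q' h), (Num.min r' s); first by rewrite lt_min r0'.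
split; last by apply: lim0M => //; exact: lim0_comp qd.
move=> h; rewrite lt_min => /andP[/fq' -> /hs]; rewrite subr0 => a.
by rewrite fq; [ring|lra].
Qed.

Lemma cderivV f z d : f z != 0 -> cderiv f z d ->
  cderiv (fun x => (f x)^-1) z (- d / (f z * f z)).
Proof.
move=> fz0 fd; have fl := cderiv_lim fd.
have [s s0 hs] := lim0_near0 fl fz0.
move: fd => [q [r r0 [fq qd]]].
exists (fun h => - q h / (f (z + h) * f z)), (Num.min r s); first by rewrite lt_min r0.
split.
  move=> h; rewrite lt_min => /andP[hr /hs].
  have nf : 0 < nm (f z) / 2 by rewrite divr_gt0// nm_gt0.
  move=> /(lt_le_trans nf); rewrite nm_gt0 => fzh.
  rewrite fq// in fzh *.
  by field; rewrite fzh fz0.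
apply: lim0M; last by apply: lim0V; [rewrite mulf_neq0|apply: lim0M => //; exact: lim0_cst].
by have := lim0M (lim0_cst (-1)) qd; rewrite mulN1r; apply: lim0_near ltr01 _ => h _; rewrite mulN1r.
Qed.

Lemma cderivZ c f z d : cderiv f z d -> cderiv (fun x => c * f x) z (c * d).
Proof.
move=> fd; have := cderivM (cderiv_cst c z) fd.
by rewrite mul0r add0r.
Qed.

Lemma cderivB f g z d d' : cderiv f z d -> cderiv g z d' ->
  cderiv (fun x => f x - g x) z (d - d').
Proof.
move=> fd gd; have := cderivD fd (cderivZ (-1) gd); rewrite mulN1r.
by under eq_fun do rewrite mulN1r.
Qed.

Lemma cderiv_shift a f z d : cderiv f (a + z) d -> cderiv (fun x => f (a + x)) z d.
Proof.
move=> fd; have := @cderiv_comp f (fun x => a + x) z d (0 + 1) fd.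
by rewrite add0r mulr1; apply; rewrite -[X in cderiv _ _ X]add0r; exact: cderivD (cderiv_cst _ _) (cderiv_id _).
Qed.

Lemma derivable_cderiv (f : plane R -> plane R) z :
  derivable f z 1 -> exists d, cderiv f z d.
Proof.
move=> /cvg_ex[/= d /cvgrPdist_le fd]; exists d; apply: cderivP => e e0.
have e0' : (0 : C) < (e%:C)%C by rewrite ltcR.
have := fd _ e0'; rewrite near_withinE => /nbhs_planeP[r r0 h]; exists r => // x x0 xr.
have := h x; rewrite subr0 => /(_ xr x0) /=.
rewrite normr_nm lecR nmBC; apply: le_trans.
by rewrite /GRing.scale /= mulr1 (addrC x) mulrC.
Qed.

End ComplexDerivative.

(** * The maximum principle and its consequences *)

Section CauchyEstimates.
Variable R : realType.
Local Notation C := (R[i]).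
Implicit Types (q f g : C -> C) (z d l : C).

Lemma ReB (x y : C) : complex.Re (x - y) = complex.Re x - complex.Re y.
Proof. by case: x; case: y. Qed.

Lemma ImB (x y : C) : complex.Im (x - y) = complex.Im x - complex.Im y.
Proof. by case: x; case: y. Qed.

Lemma cderiv_Re f (t : R) d : cderiv f (t%:C)%C d ->
  has_diff (fun s => complex.Re (f (s%:C)%C)) t (complex.Re d).
Proof.
move=> fd e e0; have [r r0 h] := cderiv_approx fd e0; exists r => // k kr.
have := h (k%:C)%C; rewrite nm_real => /(_ kr); apply: le_trans.
rewrite -rmorphD /= (_ : complex.Re d * k = complex.Re (d * (k%:C)%C)).
  by rewrite -!ReB absRe_le_nm.
by case: (d) => a b /=; rewrite mulr0 subr0.
Qed.

(** The real mean value theorem is applied along the segment to the real part of [f / (f y - f x)],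
    which increases by exactly [1]. *)
Lemma mean_value f (df : C -> C) (x y : C) (L : R) :
  (forall t : R, 0 <= t <= 1 -> let z := x + (t%:C)%C * (y - x) in
     cderiv f z (df z) /\ nm (df z) <= L) ->
  nm (f y - f x) <= L * nm (y - x).
Proof.
move=> H; have L0 : 0 <= L.
  by have [|_] := H 0; [rewrite lexx ler01|apply: le_trans (nm_ge0 _)].
have [->|fxy] := eqVneq (f y) (f x).
  by rewrite subrr nm0 mulr_ge0 ?nm_ge0.
have c0 : f y - f x != 0 by rewrite subr_eq0.
pose c := (f y - f x)^-1.
pose F (w : C) := c * f (x + w * (y - x)).
pose z (t : R) := x + (t%:C)%C * (y - x).
have dF (t : R) : 0 <= t <= 1 -> is_derive t 1 (fun s => complex.Re (F (s%:C)%C))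
    (complex.Re (c * (df (z t) * (y - x)))).
  move=> t01; apply: has_diff_is_derive; apply: cderiv_Re; apply: cderivZ.
  apply: (@cderiv_comp _ f (fun w => x + w * (y - x)) (t%:C)%C).
    by have [] := H t t01.
  have := cderivD (cderiv_cst x (t%:C)%C) (cderivM (cderiv_id (t%:C)%C) (cderiv_cst (y - x) (t%:C)%C)).
  by rewrite add0r mul1r mulr0 addr0.
have [||t] := @MVT R (fun s => complex.Re (F (s%:C)%C))
   (fun t => complex.Re (c * (df (z t) * (y - x)))) 0 1 ltr01.
- by move=> t /itvP h; apply: dF; rewrite !h.
- apply: derivable_within_continuous => t /itvP h.
  have t01 : 0 <= t <= 1 by rewrite !h.
  by have [] := dF t t01.
move=> /itvP ht; rewrite -ReB subr0 mulr1 {1 2}/F.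
rewrite (_ : x + (1%:C)%C * _ = y); last by rewrite mul1r addrC subrK.
rewrite (_ : x + (0%:C)%C * _ = x); last by rewrite mul0r addr0.
have c1 : c * (f y - f x) = 1 by exact: mulVf.
rewrite -mulrBr c1 /=.
move=> e1; have : 1 <= nm (c * (df (z t) * (y - x))).
  by rewrite e1 Re_le_nm.
rewrite /c mulrC nm_div ler_pdivlMr ?nm_gt0// mul1r => /le_trans; apply.
rewrite nmM ler_wpM2r ?nm_ge0//.
by have [|_] := H t; rewrite ?ht.
Qed.

Definition cexp (w : C) : C :=
  ((expR (complex.Re w) * cos (complex.Im w)) +i* (expR (complex.Re w) * sin (complex.Im w)))%C.

Lemma cexpD (w h : C) : cexp (w + h) = cexp w * cexp h.
Proof.
case: w h => [a b] [c d]; rewrite /cexp /= expRD cosD sinD.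
by apply/eqP; rewrite eq_complex /=; apply/andP; split; apply/eqP; ring.
Qed.

Lemma nm_cexp (w : C) : nm (cexp w) = expR (complex.Re w).
Proof.
rewrite /cexp /= !exprMn -mulrDr cos2Dsin2 mulr1 sqrtr_sqr.
by rewrite ger0_norm// expR_ge0.
Qed.

(** The addition law reduces the claim to the derivatives of [expR], [cos] and [sin] at [0]; the
    errors there add up to at most [7 e' nm h]. *)
Lemma cderiv_cexp w : cderiv cexp w (cexp w).
Proof.
have h1 : has_diff (@expR R) 0 1.
  by apply: is_derive_has_diff; rewrite -[X in is_derive _ _ _ X]expR0; exact: is_derive_expR.
have h2 : has_diff (@cos R) 0 0.
  apply: is_derive_has_diff; rewrite -[X in is_derive _ _ _ X]oppr0 -[X in - X]sin0; exact: is_derive_cos.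
have h3 : has_diff (@sin R) 0 1.
  by apply: is_derive_has_diff; rewrite -[X in is_derive _ _ _ X]cos0; exact: is_derive_sin.
apply: cderivP => e e0; have n0 : 0 < nm (cexp w) by rewrite nm_cexp expR_gt0.
pose e' : R := Num.min (e / (8 * nm (cexp w))) 1.
have e'0 : 0 < e' by rewrite lt_min ltr01 divr_gt0// mulr_gt0.
have e'1 : e' <= 1 by rewrite ge_min lexx orbT.
have e'e : e' <= e / (8 * nm (cexp w)) by rewrite ge_min lexx.
clearbody e'.
have [r1 r10 {}h1] := h1 _ e'0; have [r2 r20 {}h2] := h2 _ e'0.
have [r3 r30 {}h3] := h3 _ e'0.
pose r := Num.min (Num.min r1 r2) (Num.min r3 (Num.min e' (1/2))).
exists r; first by rewrite !lt_min r10 r20 r30 e'0 divr_gt0.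
move=> h hn0; rewrite !lt_min => /andP[/andP[hr1 hr2] /andP[hr3 /andP[he hh]]].
rewrite cexpD (_ : _ - _ = cexp w * ((cexp h - 1 - h) / h)); last by field.
rewrite nmM nm_div mulrA ler_pdivrMr ?nm_gt0//.
suff : nm (cexp h - 1 - h) <= 8 * e' * nm h.
  move=> /(ler_wpM2l (ltW n0)) /le_trans; apply.
  rewrite (_ : _ * (8 * e' * _) = (e' * (8 * nm (cexp w))) * nm h); last by ring.
  by rewrite ler_wpM2r ?nm_ge0// -ler_pdivlMr ?mulr_gt0.
apply: le_trans (nm_le_ReIm _) _.
move: (absRe_le_nm h) (absIm_le_nm h) hr1 hr2 hr3 he hh.
move: (nm h) => N; case: h {hn0} => a b /= aN bN hr1 hr2 hr3 he hh.
rewrite subr0.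
have x1 := h1 a (le_lt_trans aN hr1); have x2 := h2 b (le_lt_trans bN hr2).
have x3 := h3 b (le_lt_trans bN hr3).
rewrite !add0r expR0 cos0 sin0 !mul1r mul0r !subr0 in x1 x2 x3.
have N0 : 0 <= N by apply: le_trans aN.
have eN (u : R) : u <= N -> e' * u <= e' * N by move=> ?; rewrite ler_wpM2l// ltW.
have y1 := eN _ aN; have y2 := eN _ bN.
have E2 : `|expR a - 1| <= 2 * N.
  rewrite (_ : expR a - 1 = (expR a - 1 - a) + a); last by ring.
  apply: le_trans (ler_normD _ _) _.
  have : e' * N <= 1 * N by rewrite ler_wpM2r.
  by clear -x1 y1 aN; lra.
have ea : `|expR a| <= 2.
  rewrite (_ : expR a = (expR a - 1) + 1); last by ring.
  by apply: le_trans (ler_normD _ _) _; rewrite normr1; clear -E2 hh; lra.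
have z1 : `|expR a * (cos b - 1)| <= 2 * (e' * N).
  by rewrite normrM ler_pM// (le_trans x2).
have z2 : `|expR a * (sin b - b)| <= 2 * (e' * N).
  by rewrite normrM ler_pM// (le_trans x3).
have z3 : `|(expR a - 1) * b| <= 2 * (e' * N).
  by rewrite normrM mulrA ler_pM// (le_trans E2)// ler_wpM2l// ltW.
rewrite (_ : _ - 1 - a = (expR a - 1 - a) + expR a * (cos b - 1)); last by ring.
rewrite (_ : _ * _ - b = expR a * (sin b - b) + (expR a - 1) * b); last by ring.
apply: le_trans (lerD (ler_normD _ _) (ler_normD _ _)) _.
have : 0 <= e' * N by rewrite mulr_ge0// ltW.
clear -x1 y1 z1 z2 z3; lra.
Qed.

(** The Cauchy-Riemann equations, with the signs for which the pair is the divergence-free field of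
    [goursat]. *)
Lemma cderiv_has_diff2 f (s t : R) d : cderiv f (s +i* t)%C d ->
  has_diff2 (fun s t => complex.Re (f (s +i* t)%C)) s t (complex.Re d) (- complex.Im d) /\
  has_diff2 (fun s t => - complex.Im (f (s +i* t)%C)) s t (- complex.Im d) (- complex.Re d).
Proof.
move=> fd.
have key e : 0 < e -> exists2 r : R, 0 < r & forall h k : R, `|h| < r -> `|k| < r ->
    nm (f ((s + h) +i* (t + k))%C - f (s +i* t)%C - d * (h +i* k)%C) <= e * (`|h| + `|k|).
  move=> e0; have [r r0 H] := cderiv_approx fd e0; exists (r / 2); first by rewrite divr_gt0.
  move=> h k hr kr; have nhk := nm_le_ReIm (h +i* k)%C; rewrite /= in nhk.
  have := H (h +i* k)%C; rewrite -[(_ +i* _)%C + _]/((s + h) +i* (t + k))%C => H'.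
  apply: le_trans (H' _) _; first by apply: le_lt_trans nhk _; lra.
  by rewrite ler_wpM2l// ltW.
split=> e e0; have [r r0 H] := key e e0; exists r => // h k hr kr; have := H h k hr kr.
  apply: le_trans; apply: le_trans (absRe_le_nm _).
  by rewrite !ReB; case: (d) => a b /=; rewrite mulNr.
apply: le_trans; apply: le_trans (absIm_le_nm _).
rewrite !ImB; case: (d) => a b /=; rewrite -normrN le_eqVlt; apply/orP; left; apply/eqP.
by congr `|_|; ring.
Qed.

(* Integrating [f (exp w) / l] over the rectangle [s1, ln r] x [0, 2 pi] turns
   the circle average of [f] into a quantity that does not depend on the radius. *)
Lemma center_max f q l (M r r' : R) : 0 < r -> 0 < r' ->
  (forall z, 0 < nm z <= r -> exists d, cderiv f z d) ->
  lim0 q l -> (forall z, 0 < nm z < r' -> f z = q z) ->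
  (forall z, nm z = r -> nm (f z) <= M) -> nm l <= M.
Proof.
move=> r0 r'0 fd ql fq fM; rewrite leNgt; apply/negP => Ml.
have M0 : 0 <= M.
  have := fM (r%:C)%C; rewrite nm_real gtr0_norm// => /(_ erefl).
  by apply: le_trans; exact: nm_ge0.
have nl0 : 0 < nm l by apply: le_lt_trans Ml.
have l0 : l != 0 by rewrite -nm_gt0.
(* After division by [l] the real part is at most [M / nm l = 1 - 2 k] on the outer circle and at
   least [1 - k] on a small one. *)
pose k : R := (1 - M / nm l) / 2.
have k0 : 0 < k by rewrite divr_gt0// subr_gt0 ltr_pdivrMr// mul1r.
pose F w := l^-1 * f (cexp w).
have e0 : 0 < k * nm l by rewrite mulr_gt0.
have [r1 r10 hr1] := ql _ e0.
pose rho : R := Num.min (Num.min r1 r' / 2) (r / 2).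
have rho0 : 0 < rho by rewrite lt_min !divr_gt0// lt_min r10.
have rhor : rho < r.
  by apply: (@le_lt_trans _ _ (r / 2)); [rewrite ge_min lexx orbT|lra].
have rhor1 : rho < Num.min r1 r'.
  apply: (@le_lt_trans _ _ (Num.min r1 r' / 2)); first by rewrite ge_min lexx.
  by rewrite ltr_pdivrMr// ltr_pMr ?lt_min ?r10// ltr1n.
pose s1 := ln rho; pose w := ln r - s1.
have w0 : 0 < w by rewrite subr_gt0 ltr_ln// posrE.
have s1E : expR s1 = rho by rewrite lnK ?posrE.
have s2E : expR (s1 + w) = r by rewrite addrC subrK lnK ?posrE.
have pi20 : 0 < pi *+ 2 :> R by rewrite mulrn_wgt0// pi_gt0.
pose P s t := complex.Re (F (s +i* t)%C).
pose Q s t := - complex.Im (F (s +i* t)%C).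
have dF s t : s1 <= s <= s1 + w -> exists d, cderiv F (s +i* t)%C d.
  move=> /andP[_ sw]; have [|d fd'] := fd (cexp (s +i* t)%C).
    by rewrite nm_cexp expR_gt0 /= -s2E ler_expR.
  exists (l^-1 * (d * cexp (s +i* t)%C)); apply: cderivZ.
  exact: cderiv_comp fd' (cderiv_cexp _).
have /= G := @goursat R P Q s1 w 0 (pi *+ 2) w0 pi20 _.
have {G} : flux P Q s1 w 0 (pi *+ 2) = 0.
  apply: G => s t sw _; have [d /cderiv_has_diff2[h1 h2]] := dF s t sw.
  by exists (complex.Re d), (- complex.Im d), (- complex.Im d), (- complex.Re d); split=> //; rewrite subrr.
have Pc s t : s1 <= s <= s1 + w -> {for t, continuous (P s)}.
  by move=> sw; have [d /cderiv_has_diff2[/has_diff2_cont[]]] := dF s t sw.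
(* The horizontal sides cancel because [cexp] has period [2 pi i]. *)
have Q0 : itv_int (fun s => Q s (0 + pi *+ 2) - Q s 0) s1 (s1 + w) = 0.
  rewrite (_ : (fun s => _) = fun=> 0); first by rewrite itv_int_cst ?mul0r// lerDl ltW.
  by apply/funext => s; rewrite /Q /F /cexp /= cosD2pi sinD2pi subrr.
rewrite /flux Q0 addr0 => I0.
have : itv_int (fun t => P (s1 + w) t - P s1 t) 0 (0 + pi *+ 2) <= (- k) * (0 + pi *+ 2 - 0).
  apply: itv_int_le; first by rewrite add0r ltW.
    by apply: cont_onB => t _; apply: Pc; rewrite lexx ?andbT lerDl ltW.
  move=> t _.
  have P2 : P (s1 + w) t <= M / nm l.
    apply: le_trans (Re_le_nm _) _; rewrite /F mulrC nm_div ler_pM2r ?invr_gt0//.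
    by apply: fM; rewrite nm_cexp.
  have P1 : 1 - k <= P s1 t.
    have zr : nm (cexp (s1 +i* t)%C) = rho by rewrite nm_cexp.
    rewrite /P /F fq; last by rewrite zr rho0 (lt_le_trans rhor1)// ge_min lexx orbT.
    have := hr1 (cexp (s1 +i* t)%C); rewrite zr (lt_le_trans rhor1) ?ge_min ?lexx//.
    move=> /(_ isT); set z := q _ => zl.
    have : nm (1 - l^-1 * z) <= k.
      rewrite (_ : 1 - _ = (l - z) / l); last by field.
      by rewrite nm_div ler_pdivrMr// nmBC.
    move=> /(le_trans (Re_le_nm _)); rewrite ReB /=; lra.
  have : M / nm l = 1 - 2 * k by rewrite /k; field; rewrite gt_eqF.
  lra.
rewrite I0 add0r subr0 mulNr oppr_ge0 leNgt; apply/negP/negPn.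
by rewrite mulr_gt0.
Qed.

(** The maximum principle for the difference quotient of [f] at [a], whose value at the centre is
    the derivative. *)
Lemma cauchy_estimate f a d (M r : R) : 0 < r ->
  (forall z, nm (z - a) <= r -> exists d, cderiv f z d) -> cderiv f a d ->
  (forall z, nm (z - a) = r -> nm (f z - f a) <= M) -> nm d <= M / r.
Proof.
move=> r0 fd [q [r' r'0 [fq qd]]] fM.
apply: (@center_max (fun z => (f (a + z) - f a) / z) q d _ r r') => //.
- move=> z /andP[z0 zr]; rewrite nm_gt0 in z0.
  have [|d' fd'] := fd (a + z); first by rewrite addrAC subrr add0r.
  eexists; apply: cderivM; last exact: cderivV (cderiv_id z).
  by apply: cderivB; [exact: cderiv_shift fd'|exact: cderiv_cst].
- move=> z /andP[]; rewrite nm_gt0 => z0 /fq ->.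
  by rewrite addrAC subrr add0r mulfK.
- move=> z zr; rewrite nm_div zr ler_pM2r ?invr_gt0//; apply: fM.
  by rewrite addrAC subrr add0r.
Qed.

(** A Cauchy estimate for [u |-> f (x + u) - f (y + u)]: by the mean value inequality this function
    is at most [L * nm (y - x)] on the disc, and its derivative at [0] is [df x - df y]. *)
Lemma deriv_lipschitz f (df : C -> C) x y (L r : R) : 0 < r ->
  (forall z, nm (z - x) <= r + nm (y - x) -> cderiv f z (df z) /\ nm (df z) <= L) ->
  nm (df x - df y) <= 2 * L / r * nm (y - x).
Proof.
move=> r0 H.
have mv u : nm u <= r -> nm (f (y + u) - f (x + u)) <= L * nm (y - x).
  move=> ur; have -> : y - x = (y + u) - (x + u) by ring.
  apply: (@mean_value f df) => t t01 z; apply: H.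
  have -> : z - x = u + (t%:C)%C * (y - x) by rewrite /z; ring.
  apply: le_trans (nmD _ _) _; rewrite lerD// nmM nm_real.
  by move: t01 => /andP[t0 t1]; rewrite ger0_norm// ler_piMl// nm_ge0.
have dx : cderiv f x (df x).
  by have [] // := H x; rewrite subrr nm0 addr_ge0 ?nm_ge0// ltW.
have dy : cderiv f y (df y) by have [] // := H y; rewrite lerDr ltW.
have [qx [rx rx0 [fx qxd]]] := dx; have [qy [ry ry0 [fy qyd]]] := dy.
rewrite mulrAC.
apply: (@center_max (fun u => ((f (x + u) - f x) - (f (y + u) - f y)) / u)
  (fun u => qx u - qy u) _ _ r (Num.min rx ry)) => //.
- by rewrite lt_min rx0.
- move=> u /andP[u0 ur]; rewrite nm_gt0 in u0.
  have [|dxu _] := H (x + u).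
    by rewrite addrAC subrr add0r (le_trans ur)// lerDl nm_ge0.
  have [|dyu _] := H (y + u).
    by rewrite addrAC addrC; apply: le_trans (nmD _ _) _; rewrite lerD2r.
  eexists; apply: cderivM; last exact: cderivV (cderiv_id u).
  by apply: cderivB; apply: cderivB; [exact: cderiv_shift dxu|exact: cderiv_cst|exact: cderiv_shift dyu|exact: cderiv_cst].
- have := lim0M (lim0_cst (-1)) qyd; rewrite mulN1r => /(lim0D qxd).
  by apply: lim0_near ltr01 _ => u _; rewrite mulN1r.
- move=> u /andP[]; rewrite nm_gt0 lt_min => u0 /andP[/fx -> /fy ->].
  by field.
- move=> u ur; rewrite nm_div ur ler_pM2r ?invr_gt0//.
  have := mv 0; rewrite !addr0 nm0 => /(_ (ltW r0)) m1.
  have := mv u; rewrite ur lexx => /(_ isT) m2.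
  have -> : f (x + u) - f x - (f (y + u) - f y) = (f y - f x) - (f (y + u) - f (x + u)).
    by ring.
  apply: le_trans (nmD _ _) _; rewrite nmN.
  lra.
Qed.

Lemma nm_segment (x y b : C) (t e : R) : 0 <= t <= 1 -> nm (x - b) <= e -> nm (y - b) <= e ->
  nm (x + (t%:C)%C * (y - x) - b) <= e.
Proof.
move=> /andP[t0 t1] xe ye.
rewrite (_ : _ - b = ((1 - t)%:C)%C * (x - b) + (t%:C)%C * (y - b)); last first.
  by rewrite rmorphB rmorph1; ring.
apply: le_trans (nmD _ _) _; rewrite !nmM !nm_real !ger0_norm ?subr_ge0//.
have h1 : (1 - t) * nm (x - b) <= (1 - t) * e by rewrite ler_wpM2l// subr_ge0.
have h2 : t * nm (y - b) <= t * e by rewrite ler_wpM2l.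
lra.
Qed.

Lemma almost_linear f (df : C -> C) (b x y : C) (e L : R) :
  (forall z, nm (z - b) <= e -> cderiv f z (df z) /\ nm (df z - df b) <= L) ->
  nm (x - b) <= e -> nm (y - b) <= e ->
  nm (f y - f x - df b * (y - x)) <= L * nm (y - x).
Proof.
move=> H xe ye.
rewrite (_ : _ - _ = (f y - df b * y) - (f x - df b * x)); last by ring.
apply: (@mean_value (fun z => f z - df b * z) (fun z => df z - df b)) => t t01 z.
have [fz dz] := H z (nm_segment t01 xe ye); split => //.
apply: cderivB => //.
by have := cderivZ (df b) (cderiv_id z); rewrite mulr1.
Qed.

Lemma lipschitz_ball f (df : C -> C) (b x y : C) (e L : R) :
  (forall z, nm (z - b) <= e -> cderiv f z (df z) /\ nm (df z) <= L) ->
  nm (x - b) <= e -> nm (y - b) <= e ->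
  nm (f y - f x) <= L * nm (y - x).
Proof.
move=> H xe ye; apply: (@mean_value f df) => t t01 z; exact: H (nm_segment t01 xe ye).
Qed.

Lemma closed_circle (r : R) : closed ([set z | nm z = r] : set (plane R)).
Proof.
move=> z /closureP_plane H /=; apply/eqP; rewrite -subr_eq0 -normr_eq0.
rewrite eq_le normr_ge0 andbT; apply/ler_addgt0Pr => e e0; rewrite add0r.
have [y /= <- /ltW yz] := H e e0; apply: le_trans yz.
rewrite ler_norml; have := nm_leB y z; have := nm_leB z y; rewrite (nmBC z).
by move=> h1 h2; apply/andP; split; lra.
Qed.

Lemma exists_natr_gt (x : R) : exists n : nat, x < n%:R.
Proof. by exists (Num.truncn x).+1; exact: truncnS_gt. Qed.

Lemma exists_natr_inv (x : R) : 0 < x -> exists n : nat, n.+1%:R^-1 <= x.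
Proof.
move=> x0; have [n hn] := exists_natr_gt x^-1; exists n.
rewrite -[leRHS]invrK lef_pV2 ?posrE ?invr_gt0// ltW// (lt_le_trans hn)//.
by rewrite ler_nat.
Qed.

(* The bound on [df c] comes from applying the maximum principle to
   [u / (f (c + u) - f (c - u))], whose value at [0] is [1 / (2 df c)]. *)
Lemma injective_deriv_neq0 f (df : C -> C) (a : C) (r M : R) : 0 < r ->
  (forall z, nm (z - a) <= 4 * r -> cderiv f z (df z) /\ nm (f z) <= M) ->
  (forall z w, nm (z - a) <= 4 * r -> nm (w - a) <= 4 * r -> f z = f w -> z = w) ->
  df a != 0.
Proof.
move=> r0 fM finj; apply/negP => /eqP da0.
pose L : R := (M + M) / r.
have fL z : nm (z - a) <= 3 * r -> cderiv f z (df z) /\ nm (df z) <= L.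
  move=> zr; have zr4 : nm (z - a) <= 4 * r by lra.
  have [fz Mz] := fM z zr4; split => //.
  have wr w : nm (w - z) <= r -> nm (w - a) <= 4 * r.
    by move=> wz; apply: le_trans (nmB_trans z w a) _; lra.
  apply: (cauchy_estimate r0 _ fz).
    by move=> w /wr/fM[fw _]; exists (df w).
  move=> w wz; apply: le_trans (nmD _ _) _; rewrite nmN lerD//.
  by have [] // := fM w; apply: wr; rewrite wz.
clearbody L; have L0 : 0 <= L.
  by have [|_] := fL a; [rewrite subrr nm0; lra|apply: le_trans; exact: nm_ge0].
have lip := lipschitz_ball fL.
have nmDl (u v : C) (e e' : R) : nm (u - a) <= e -> nm v <= e' -> nm (u + v - a) <= e + e'.
  by move=> h1 h2; rewrite addrAC; apply: le_trans (nmD _ _) _; exact: lerD.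
have nmBl (u v : C) (e e' : R) : nm (u - a) <= e -> nm v <= e' -> nm (u - v - a) <= e + e'.
  by move=> h1 h2; apply: nmDl => //; rewrite nmN.
have aa (e : R) : 0 <= e -> nm (a - a) <= e by rewrite subrr nm0.
have [m m0 hm] : exists2 m : R, 0 < m & forall u, nm u = r -> m <= nm (f (a + u) - f (a - u)).
  have cc : compact ([set z | nm z = r] : set (plane R)).
    by apply: (@bounded_closed_compact_plane R _ r); [exact: closed_circle|move=> x ->].
  have [|u ur|n hn] := @compact_uniform R _ (fun n u => n.+1%:R^-1 <= nm (f (a + u) - f (a - u))) cc.
  - move=> n k x nk; apply: le_trans; rewrite lef_pV2 ?posrE ?ltr0Sn// ler_nat.
    by rewrite ltnS.
  - have v0 : 0 < nm (f (a + u) - f (a - u)).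
      apply: nmB_gt0 => /finj; rewrite /= in ur.
      have -> : a + u - a = u by ring.
      have -> : a - u - a = - u by ring.
      rewrite nmN ur => /(_ _ _) e; have : a + u = a - u by apply: e; lra.
      move=> {}e; have : 2 * u = 0.
        by rewrite (_ : 2 * u = (a + u) - (a - u)); [rewrite e subrr|ring].
      move=> /eqP; rewrite mulf_eq0 pnatr_eq0 /= => /eqP u0.
      by move: ur r0; rewrite u0 nm0 => <-; rewrite ltxx.
    move: v0; set v := nm _ => v0.
    have [n hn] : exists n : nat, n.+1%:R^-1 <= v / 2 by apply: exists_natr_inv; rewrite divr_gt0.
    exists n; exists (v / (4 * (L + 1))); first by rewrite divr_gt0// mulr_gt0// ltr_wpDl.
    move=> w wr wu; apply: le_trans hn _; rewrite /= in ur wr.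
    have h1 : nm (f (a + w) - f (a + u)) <= L * nm (w - u).
      rewrite (_ : w - u = (a + w) - (a + u)); last by ring.
      by apply: lip; apply: le_trans (nmDl a _ 0 r _ _) _; rewrite ?aa ?ur ?wr//; lra.
    have h2 : nm (f (a - w) - f (a - u)) <= L * nm (w - u).
      rewrite -(nmN (w - u)) (_ : - (w - u) = (a - w) - (a - u)); last by ring.
      by apply: lip; apply: le_trans (nmBl a _ 0 r _ _) _; rewrite ?aa ?ur ?wr//; lra.
    have h3 : L * nm (w - u) <= v / 4.
      have : (L + 1) * nm (w - u) <= v / 4.
        rewrite mulrC -ler_pdivlMr ?ltr_wpDl//; apply: le_trans (ltW wu) _.
        by rewrite invfM mulrA.
      by apply: le_trans; rewrite ler_wpM2r ?nm_ge0// lerDl.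
    have := nm_leB (f (a + u) - f (a - u)) (f (a + w) - f (a - w)).
    rewrite -/v (_ : _ - _ - _ = (f (a - w) - f (a - u)) - (f (a + w) - f (a + u))); last by ring.
    have := nmD (f (a - w) - f (a - u)) (- (f (a + w) - f (a + u))).
    rewrite nmN; lra.
  by exists n.+1%:R^-1; [rewrite invr_gt0 ltr0Sn|move=> u ur; apply: hn].
pose e : R := Num.min r (m / (8 * (L + 1))).
have L1 : 0 < L + 1 by rewrite ltr_wpDl.
have e0 : 0 < e by rewrite lt_min r0 divr_gt0// mulr_gt0.
have er : e <= r by rewrite ge_min lexx.
have Le : L * e <= m / 8.
  have : (L + 1) * e <= m / 8.
    by rewrite mulrC -ler_pdivlMr// /e ge_min; apply/orP; right; rewrite invfM mulrA.
  by apply: le_trans; rewrite ler_wpM2r ?ltW// ltrDl.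
have sep c u : nm (c - a) <= e -> nm u = r -> m / 2 <= nm (f (c + u) - f (c - u)).
  move=> ca ur.
  have h1 : nm (f (c + u) - f (a + u)) <= L * nm (c - a).
    rewrite (_ : c - a = (c + u) - (a + u)); last by ring.
    apply: lip; first by apply: le_trans (nmDl a _ 0 r _ _) _; rewrite ?aa ?ur//; lra.
    by apply: le_trans (nmDl c _ e r _ _) _; rewrite ?ur//; lra.
  have h2 : nm (f (c - u) - f (a - u)) <= L * nm (c - a).
    rewrite (_ : c - a = (c - u) - (a - u)); last by ring.
    apply: lip; first by apply: le_trans (nmBl a _ 0 r _ _) _; rewrite ?aa ?ur//; lra.
    by apply: le_trans (nmBl c _ e r _ _) _; rewrite ?ur//; lra.
  have h3 : L * nm (c - a) <= m / 8 by apply: le_trans Le; rewrite ler_wpM2l.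
  have := nm_leB (f (a + u) - f (a - u)) (f (c + u) - f (c - u)).
  rewrite (_ : _ - _ - (_ - _) = (f (c - u) - f (a - u)) - (f (c + u) - f (a + u))); last by ring.
  have := nmD (f (c - u) - f (a - u)) (- (f (c + u) - f (a + u))).
  have := hm u ur; rewrite nmN; lra.
(* Near [a] the derivative is either zero or bounded below by a fixed constant. Being Lipschitz and
   zero at [a], it must vanish on a neighbourhood, where [f] is then constant, against
   injectivity. *)
have big c : nm (c - a) <= e -> df c != 0 -> m / (4 * r) <= nm (df c).
  move=> ca dc0; have [|fc _] := fL c; first by lra.
  have [q [r' r'0 [fq qd]]] := fc.
  pose q' u := q u + q (- u).
  have q'd : lim0 q' (df c + df c).
    apply: lim0D => //; apply: (@lim0_comp R q _ (fun u => - u)) => //.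
    by have := lim0M (lim0_cst (-1)) (@lim0_id R); rewrite mulr0; apply: lim0_near ltr01 _ => u _; rewrite mulN1r.
  have d20 : df c + df c != 0 by rewrite -mulr2n mulrn_eq0.
  have : nm (df c + df c)^-1 <= r / (m / 2).
    apply: (@center_max (fun u => u / (f (c + u) - f (c - u))) (fun u => (q' u)^-1) _ _ r r') => //.
    - move=> u /andP[u0 ur]; rewrite nm_gt0 in u0.
      have cu1 : nm (c + u - a) <= 2 * r by apply: le_trans (nmDl c _ e r _ _) _ => //; lra.
      have cu2 : nm (c - u - a) <= 2 * r by apply: le_trans (nmBl c _ e r _ _) _ => //; lra.
      have [|d1 _] := fL (c + u); first by lra.
      have [|d2 _] := fL (c - u); first by lra.
      eexists; apply: cderivM; first exact: cderiv_id.
      apply: cderivV; last first.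
        apply: cderivB; first exact: cderiv_shift d1.
        apply: (@cderiv_comp R f (fun u => c - u)); first exact: d2.
        by apply: cderivB; [exact: cderiv_cst|exact: cderiv_id].
      rewrite subr_eq0; apply/eqP => /finj cc.
      have : c + u = c - u by apply: cc; lra.
      move=> {}cc; have : 2 * u = 0.
        by rewrite (_ : 2 * u = (c + u) - (c - u)); [rewrite cc subrr|ring].
      by move=> /eqP; rewrite mulf_eq0 pnatr_eq0 (negbTE u0).
    - exact: lim0V.
    - move=> u /andP[]; rewrite nm_gt0 => u0 ur; rewrite fq// fq ?nmN//.
      rewrite (_ : _ - _ = q' u * u); last by rewrite /q'; ring.
      by rewrite invfM mulrCA divff// mulr1.
    - move=> u ur; have su := sep c u ca ur.
      rewrite nm_div ur; apply: ler_wpM2l; first exact: ltW.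
      have su0 : 0 < nm (f (c + u) - f (c - u)) by apply: lt_le_trans su; rewrite divr_gt0.
      by rewrite lef_pV2 // ?posrE ?divr_gt0.
  have n2 : nm (df c + df c) = 2 * nm (df c).
    by rewrite (_ : df c + df c = 2%:R * df c) ?nmM ?nm_nat//; ring.
  have dc : 0 < nm (df c) by rewrite nm_gt0.
  rewrite nmV n2 -(invrK (r / (m / 2))) lef_pV2 ?posrE ?invr_gt0 ?divr_gt0 ?mulr_gt0//.
  rewrite invf_div => h; rewrite invfM mulrA.
  by rewrite ler_pdivrMr//; move: h; rewrite ler_pdivrMr//; lra.
pose e2 : R := Num.min e (m / (16 * (L + 1))).
have e20 : 0 < e2 by rewrite lt_min e0 divr_gt0// mulr_gt0.
have e2e : e2 <= e by rewrite ge_min lexx.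
have zero c : nm (c - a) <= e2 -> df c = 0.
  move=> ca; apply/eqP; apply: contraT => dc0.
  have ce : nm (c - a) <= e by apply: le_trans ca _; rewrite ge_min lexx.
  have := big c ce dc0; have := @deriv_lipschitz f df a c L r r0.
  rewrite da0 sub0r nmN => H.
  have {}H : nm (df c) <= 2 * L / r * nm (c - a).
    by apply: H => z za; apply: fL; lra.
  move=> /le_trans/(_ H); rewrite leNgt => /negP[].
  have Lc : L * nm (c - a) <= m / 16.
    have : (L + 1) * nm (c - a) <= m / 16.
      rewrite mulrC -ler_pdivlMr//; apply: le_trans ca _.
      by rewrite ge_min; apply/orP; right; rewrite invfM mulrA.
    by apply: le_trans; rewrite ler_wpM2r ?nm_ge0// lerDl.
  have -> : m / (4 * r) = m / 4 / r by rewrite invfM mulrA.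
  rewrite (_ : 2 * L / r * nm (c - a) = 2 * (L * nm (c - a)) / r); last by ring.
  by rewrite ltr_pM2r ?invr_gt0//; lra.
have [a' a'a a'e] : exists2 a', a' <> a & nm (a' - a) <= e2.
  exists (a + (e2%:C)%C); last by rewrite addrAC subrr add0r nm_real gtr0_norm.
  move=> /eqP; rewrite -subr_eq0 addrAC subrr add0r -nm_eq0 nm_real.
  by rewrite normr_eq0 gt_eqF.
apply: a'a; apply: finj.
- by clear -a'e e2e er r0; lra.
- by apply: aa; clear -r0; lra.
apply: nmB_eq0; rewrite -(mul0r (nm (a' - a))).
apply: (@lipschitz_ball f df a) a'e; last by rewrite aa// ltW.
move=> z ze; rewrite zero// nm0; split => //.
have [|] := fL z; last by rewrite zero.
by clear -ze e2e er r0; lra.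
Qed.

End CauchyEstimates.

(** * Contraction of the iterates *)

Lemma finite_uniform (I : finType) (P : I -> nat -> Prop) :
  (forall i n m, (n <= m)%N -> P i n -> P i m) -> (forall i, exists n, P i n) ->
  exists n, forall i, P i n.
Proof.
move=> mono H; have [f fP] := choice H; exists (\max_i f i)%N => i.
by apply: mono (fP i); exact: leq_bigmax.
Qed.

Section Contraction.
Variables (R : realType) (G : holomorphic_ifs R).
Local Notation C := (R[i]).
Local Notation Om := (ifs_dom G).
Local Notation g := (@ifs_map R G).
Implicit Types (x y z : C) (w : seq (ifs_index G)).

Definition in_ball (U : set (plane R)) (x : C) (r : R) := forall y : C, nm (y - x) <= r -> U y.

Lemma in_ballS (U : set (plane R)) x r y r' :
  in_ball U x r -> nm (y - x) + r' <= r -> in_ball U y r'.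
Proof.
move=> xr h z zy; apply: xr; apply: le_trans (nmB_trans y z x) _.
by rewrite addrC (le_trans _ h)// lerD2l.
Qed.

Lemma open_in_ball (U : set (plane R)) x : open U -> U x -> exists2 r : R, 0 < r & in_ball U x r.
Proof.
rewrite openE => /(_ x) H /H /nbhs_planeP[d d0 h]; exists (d / 2); first by rewrite divr_gt0.
by move=> y yd; apply: h; lra.
Qed.

Lemma compact_in_ball (U K : set (plane R)) : open U -> compact K -> K `<=` U ->
  exists2 r : R, 0 < r & forall x, K x -> in_ball U x r.
Proof.
move=> oU cK KU.
have [|x Kx|n hn] := @compact_uniform R K (fun n x => in_ball U x n.+1%:R^-1) cK.
- move=> n m x nm' h y yx; apply: h; apply: le_trans yx _.
  by rewrite lef_pV2 ?posrE ?ltr0Sn// ler_nat ltnS.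
- have [r r0 xr] := open_in_ball oU (KU x Kx).
  have [n hn] : exists n : nat, n.+1%:R^-1 <= r / 2 by apply: exists_natr_inv; rewrite divr_gt0.
  exists n; exists (r / 2); first by rewrite divr_gt0.
  by move=> y _ yx; apply: in_ballS xr _; rewrite (splitr r) lerD// ltW.
by exists n.+1%:R^-1 => //; rewrite invr_gt0 ltr0Sn.
Qed.

Lemma dom_bounded : exists2 M : R, 0 < M & forall z, Om z -> nm z <= M.
Proof.
have [M [Mr H]] := ifs_dom_bounded G.
exists (`|complex.Re M| + 1); first by rewrite ltr_wpDl.
move=> z Oz; have := H ((`|complex.Re M| + 1)%:C)%C _ z Oz.
rewrite /= normr_nm lecR; apply.
rewrite -(RRe_real Mr) ltcR /=.
by apply: le_lt_trans (ler_norm _) _; rewrite ltrDl.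
Qed.

Lemma dom_collar : exists2 r : R, 0 < r & forall i z, Om z -> in_ball Om (g i z) r.
Proof.
have [M M0 OM] := dom_bounded.
have cl i : compact (closure (g i @` Om)).
  apply: (@bounded_closed_compact_plane R _ (M + 1)); first exact: closed_closure.
  move=> x /closureP_plane/(_ 1 ltr01)[y [z Oz <-]] yx.
  apply: le_trans (nm_leB x (g i z)) _; rewrite nmBC; apply: lerD; last exact: ltW.
  by apply: OM; exact: ifs_map_into.
have [|i|n hn] := @finite_uniform (ifs_index G)
    (fun i n => forall z, Om z -> in_ball Om (g i z) n.+1%:R^-1).
- move=> i n m nm' h z Oz y yx; apply: (h z Oz); apply: le_trans yx _.
  by rewrite lef_pV2 ?posrE ?ltr0Sn// ler_nat ltnS.
- have [r r0 hr] := compact_in_ball (@ifs_dom_open R G) (cl i) (@ifs_map_closure R G i).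
  have [n hn] := exists_natr_inv r0; exists n => z Oz y yz.
  apply: (hr (g i z)); last exact: le_trans hn.
  by apply: subset_closure; exists z.
by exists n.+1%:R^-1 => //; rewrite invr_gt0 ltr0Sn.
Qed.

Lemma map_cderiv i z : Om z -> exists d, cderiv (g i) z d.
Proof. by move=> Oz; apply: derivable_cderiv; exact: ifs_map_holomorphic. Qed.

Lemma word_map_dom w z : Om z -> Om (word_map w z).
Proof. by move=> Oz; elim: w => //= i w; exact: ifs_map_into. Qed.

Lemma word_map_cat w w' z : word_map (w ++ w') z = word_map w (word_map w' z) :> C.
Proof. by rewrite /word_map foldr_cat. Qed.

(* Earle-Hamilton: replacing each [g_i] by [z |-> g_i z + e (g_i z - g_i p)] along
   the orbit of [x] keeps the composite inside the domain, and multiplies its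
   derivative at [x] by [1 + e] per letter. *)
Lemma earle_hamilton : exists2 e : R, 0 < e & forall w x, Om x ->
  exists H : C -> C, exists d, [/\ forall z, Om z -> Om (H z),
    forall z, Om z -> exists d, cderiv H z d, H x = word_map w x,
    cderiv (word_map w) x d & cderiv H x (((1 + e) ^+ size w)%:C%C * d)].
Proof.
have [M M0 OM] := dom_bounded; have [r r0 Or] := dom_collar.
(* [e (g_i z - g_i p)] has modulus at most [2 M e = r], the width of the collar. *)
pose e := r / (2 * M); have e0 : 0 < e by rewrite divr_gt0// mulr_gt0.
exists e => // w x Ox; elim: w => [|i w [H [d [HO Hd Hx wd Hxd]]]].
  exists id, 1; split => //.
  - by move=> z _; exists 1; exact: cderiv_id.
  - exact: cderiv_id.
  - by rewrite expr0 mulr1; exact: cderiv_id.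
have Op := word_map_dom w Ox; set p := word_map w x in Hx Op.
pose ghat z := g i z + (e%:C)%C * (g i z - g i p).
have ghat_d z d' : cderiv (g i) z d' -> cderiv ghat z (d' + (e%:C)%C * (d' - 0)).
  by move=> gd; apply: cderivD => //; apply: cderivZ; apply: cderivB => //; exact: cderiv_cst.
have [d' pd] := map_cderiv i Op.
exists (fun z => ghat (H z)), (d' * d); split.
- move=> z /HO OHz; apply: (Or i (H z) OHz).
  rewrite /ghat addrAC subrr add0r nmM nm_real gtr0_norm//.
  apply: (@le_trans _ _ (e * (2 * M))); last by rewrite /e divfK// gt_eqF// mulr_gt0.
  apply: ler_wpM2l; first exact: ltW.
  apply: le_trans (nmD _ _) _.
  rewrite nmN (_ : 2 * M = M + M); last by ring.
  by apply: lerD; apply: OM; exact: ifs_map_into.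
- move=> z Oz; have [d1 h1] := Hd z Oz; have [d2 h2] := map_cderiv i (HO z Oz).
  by eexists; apply: cderiv_comp h1; exact: ghat_d h2.
- by rewrite Hx /ghat subrr mulr0 addr0.
- exact: cderiv_comp pd wd.
- rewrite /= (_ : _ * _ = (d' + (e%:C)%C * (d' - 0)) * (((1 + e) ^+ size w)%:C%C * d)).
    by apply: cderiv_comp Hxd; rewrite Hx; exact: ghat_d.
  by rewrite exprS rmorphM rmorphD rmorph1; ring.
Qed.

Lemma lipschitz_ball_ex (f : C -> C) (b x y : C) (e L : R) :
  (forall z, nm (z - b) <= e -> exists2 d, cderiv f z d & nm d <= L) ->
  nm (x - b) <= e -> nm (y - b) <= e ->
  nm (f y - f x) <= L * nm (y - x).
Proof.
move=> H; have /choice[df dfP] : forall z, exists d, nm (z - b) <= e -> cderiv f z d /\ nm d <= L.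
  move=> z; have [/H[d h1 h2]|h] := boolP (nm (z - b) <= e); first by exists d.
  by exists 0.
exact: (@lipschitz_ball R f df).
Qed.

(** Cauchy's estimate bounds the derivative of the amplified composite independently of the word, so
    the amplification [(1 + e) ^+ size w] turns into a decay at rate [th = (1 + e)^-1] for
    [word_map w]. *)
Lemma local_contraction : exists2 th : R, 0 < th < 1 & exists2 M : R, 0 < M &
  forall w x y r, 0 < r -> in_ball Om x (2 * r) -> nm (y - x) <= r ->
  nm (word_map w y - word_map w x) <= M / r * th ^+ size w * nm (y - x).
Proof.
have [e e0 EH] := earle_hamilton; have [M M0 OM] := dom_bounded.
have e1 : 0 < 1 + e by rewrite addr_gt0.
exists (1 + e)^-1; first by rewrite invr_gt0 e1 invf_lt1// ltrDl.
exists (2 * M); first by rewrite mulr_gt0.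
move=> w x y r r0 xr yx.
apply: (@lipschitz_ball_ex _ x _ _ r) => //; last by rewrite subrr nm0 ltW.
move=> z zx; have zr : in_ball Om z r by apply: in_ballS xr _; lra.
have Oz : Om z by apply: zr; rewrite subrr nm0 ltW.
have [H [d [HO Hd Hz wd Hzd]]] := EH w z Oz; exists d => //.
have : nm (((1 + e) ^+ size w)%:C%C * d) <= (2 * M) / r.
  apply: (@cauchy_estimate _ H z _ _ _ r0 _ Hzd).
    by move=> u /zr/Hd.
  move=> u uz; apply: le_trans (nmD _ _) _; rewrite nmN.
  rewrite (_ : 2 * M = M + M); last by ring.
  by apply: lerD; apply: OM; apply: HO => //; apply: zr; rewrite uz.
have ek : 0 < (1 + e) ^+ size w by rewrite exprn_gt0.
by rewrite nmM nm_real (gtr0_norm ek) exprVn => h; rewrite ler_pdivlMr// mulrC.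
Qed.

(** The hypothesis works inside small discs only. The set of points whose orbits approach that of
    [x] at rate [th] is open and closed in the domain, which is connected. *)
Lemma orbit_contraction (th M : R) : 0 < th < 1 -> 0 < M ->
  (forall w x y r, 0 < r -> in_ball Om x (2 * r) -> nm (y - x) <= r ->
    nm (word_map w y - word_map w x) <= M / r * th ^+ size w * nm (y - x)) ->
  forall x y, Om x -> Om y ->
  exists K : R, forall w, nm (word_map w y - word_map w x) <= K * th ^+ size w.
Proof.
move=> th01 M0 LC x y Ox Oy.
have th0 : 0 <= th by move: th01 => /andP[/ltW].
pose B := [set y : plane R | Om y /\ exists K : R, forall w, nm (word_map w y - word_map w x) <= K * th ^+ size w].
have Bx : B x.
  by split => //; exists 0 => w; rewrite subrr nm0 mul0r.
have loc z : Om z -> exists2 r : R, 0 < r & forall u, nm (u - z) <= r -> Om u /\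
    exists K : R, forall w, nm (word_map w u - word_map w z) <= K * th ^+ size w.
  move=> Oz; have [r r0 zr] := open_in_ball (@ifs_dom_open R G) Oz.
  have r20 : 0 < r / 2 by rewrite divr_gt0.
  exists (r / 2) => // u uz; split; first by apply: zr; lra.
  exists M => w; have := @LC w z u (r / 2) r20.
  rewrite mulrC divfK// => /(_ zr uz) /le_trans; apply.
  rewrite mulrAC ler_wpM2r ?exprn_ge0//.
  rewrite mulrAC ler_pdivrMr// ler_wpM2l// ltW//.
have trans z u : (exists K : R, forall w, nm (word_map w u - word_map w z) <= K * th ^+ size w) ->
    (exists K : R, forall w, nm (word_map w z - word_map w x) <= K * th ^+ size w) ->
    (exists K : R, forall w, nm (word_map w u - word_map w x) <= K * th ^+ size w).
  move=> [K hK] [K' hK']; exists (K + K') => w; rewrite mulrDl.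
  by apply: le_trans (nmB_trans (word_map w z) _ _) _; apply: lerD.
suff BO : B = Om by have [] : B y by rewrite BO.
have := @ifs_dom_connected R G; rewrite /connected; apply; first by exists x.
  exists B; last by apply/seteqP; split => [z [Oz ?]|z []].
  rewrite openE => z [Oz Bz]; apply/nbhs_planeP.
  have [r r0 hr] := loc z Oz; exists r => // u /ltW/hr[Ou uz]; split => //.
  exact: trans Bz.
exists (closure B); first exact: closed_closure.
apply/seteqP; split => [z Bz|z [Oz /closureP_plane Bz]].
  by split; [case: Bz|exact: subset_closure].
split => //; have [r r0 hr] := loc z Oz; have [u [Ou Bu]] := Bz r r0.
move=> /ltW/hr[_ [K hK]].
by apply: (trans u) => //; exists K => w; rewrite nmBC.
Qed.

End Contraction.

(** * Geometry of the attractor *)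

Section Attractor.
Variable R : realType.
Local Notation C := (R[i]).

(** Convertible to [word_map] when [g] is [ifs_map]; detached from [holomorphic_ifs] so that the
    metric part involves no domain. *)
Definition wmap (I : finType) (g : I -> C -> C) (w : seq I) (z : C) : C := foldr g z w.

Definition quot (f : C -> C) (x y : C) : C := (f x - f y) / (x - y).

(* The metric consequences of holomorphy and hyperbolic contraction on which
   the comparison of two systems relies. *)
Record conf_sys (I : finType) (g : I -> C -> C) (A : set C) (K th C1 sg D : R) : Prop := ConfSys {
  cs_K : 0 < K ;
  cs_th : 0 < th < 1 ;
  cs_C1 : 0 < C1 ;
  cs_sg : 0 < sg ;
  cs_D : 0 < D ;
  cs_diam : forall x y, A x -> A y -> nm (x - y) <= D ;
  cs_into : forall i x, A x -> A (g i x) ;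
  cs_cover : forall x, A x -> exists i y, A y /\ x = g i y ;
  cs_inj : forall i x y, A x -> A y -> g i x = g i y -> x = y ;
  cs_contr : forall w x y, A x -> A y ->
    nm (wmap g w x - wmap g w y) <= K * th ^+ size w * nm (x - y) ;
  cs_quot : forall i d x y x' y', A x -> A y -> A x' -> A y' -> x <> y -> x' <> y' ->
    nm (y - x) <= d -> nm (x' - x) <= d -> nm (y' - x) <= d ->
    nm (quot (g i) x y - quot (g i) x' y') <= C1 * d * nm (quot (g i) x' y') ;
  cs_sep : forall i j x y, i != j -> A x -> A y -> sg <= nm (g i x - g j y)
}.

(** Compactness is used in [y], then in [x]. Moving a point changes [nm (x - y)] slightly, hence the
    gap from [e] to [e'] with [m] halfway. The lemma serves with [h = k] for expansion at large
    distances, and with negative [e] and [e'], where the distance condition is void, for separating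
    two pieces. *)
Lemma compact_separation (A : set (plane R)) (h k : C -> C) (L e e' : R) : compact A ->
  0 <= L -> e < e' ->
  (forall x y, A x -> A y -> nm (h x - h y) <= L * nm (x - y)) ->
  (forall x y, A x -> A y -> nm (k x - k y) <= L * nm (x - y)) ->
  (forall x y, A x -> A y -> e <= nm (x - y) -> h x <> k y) ->
  exists2 c : R, 0 < c & forall x y, A x -> A y -> e' <= nm (x - y) -> c <= nm (h x - k y).
Proof.
move=> cA L0 ee' hL kL hk; pose m := (e + e') / 2.
have L1 : 0 < L + 1 by rewrite ltr_wpDl.
have Lb (u v : R) : 0 <= u -> u < v / (L + 1) -> L * u <= v.
  move=> u0; rewrite ltr_pdivlMr// => uv; apply: le_trans (ltW uv).
  by rewrite mulrC ler_wpM2l// lerDl.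
have [|a Aa|n hn] := @compact_uniform R A (fun n x => forall y, A y -> e' <= nm (x - y) ->
    n.+1%:R^-1 <= nm (h x - k y)) cA; last first.
- by exists n.+1%:R^-1 => [|x y Ax]; [rewrite invr_gt0 ltr0Sn|exact: hn].
- have [|b Ab|n hn] := @compact_uniform R A (fun n y => m <= nm (a - y) ->
    n.+1%:R^-1 <= nm (h a - k y)) cA.
  + move=> n p x np H /H; apply: le_trans.
    by rewrite lef_pV2 ?posrE ?ltr0Sn// ler_nat ltnS.
  + have [ab|ab] := ltP (nm (a - b)) e.
      exists 0%N; exists ((e' - e) / 2); first by rewrite divr_gt0// subr_gt0.
      move=> y Ay; rewrite (nmBC y b) => yb my; have := nmB_trans b a y.
      by move: my; rewrite /m; lra.
    have v0 : 0 < nm (h a - k b) by apply: nmB_gt0; exact: hk.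
    have v20 : 0 < nm (h a - k b) / 2 by rewrite divr_gt0.
    have [n hn] := exists_natr_inv v20.
    exists n; exists (nm (h a - k b) / 2 / (L + 1)); first by rewrite divr_gt0.
    move=> y Ay yb _; apply: le_trans hn _.
    have := Lb _ _ (nm_ge0 _) yb; have := kL y b Ay Ab.
    have := nm_leB (h a - k b) (h a - k y).
    by rewrite (_ : h a - k b - _ = k y - k b); [lra|ring].
  exists n.*2.+1.
  have n20 : 0 < (n.*2.+2%:R : R)^-1 by rewrite invr_gt0 ltr0Sn.
  have n2 : n.+1%:R^-1 = (n.*2.+2%:R : R)^-1 + (n.*2.+2%:R)^-1.
    by rewrite -doubleS -muln2 natrM invfM -splitr.
  exists (Num.min ((e' - e) / 2) ((n.*2.+2%:R)^-1 / (L + 1))).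
    by rewrite lt_min !divr_gt0// subr_gt0.
  move=> x Ax; rewrite lt_min => /andP[xa xa'] y Ay xy.
  have may : m <= nm (a - y).
    by have := nmB_trans a x y; move: xa; rewrite /m; lra.
  have := hn y Ay may; have := Lb _ _ (nm_ge0 _) xa'; have := hL x a Ax Aa.
  have := nm_leB (h a - k y) (h x - k y).
  rewrite n2 (_ : h a - k y - _ = - (h x - h a)); last by ring.
  rewrite nmN; set u := (_%:R)^-1; lra.
move=> n p x np H y Ay /(H y Ay); apply: le_trans.
by rewrite lef_pV2 ?posrE ?ltr0Sn// ler_nat ltnS.
Qed.

Variables (G : holomorphic_ifs R) (A : set (plane R)).
Hypothesis attr : is_attractor G A.
Local Notation Om := (ifs_dom G).
Local Notation g := (@ifs_map R G).
Implicit Type w : seq (ifs_index G).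

Let cA : compact A. Proof. by case: attr. Qed.
Let AO : A `<=` Om. Proof. by case: attr. Qed.

Lemma attr_into i x : A x -> A (g i x).
Proof.
case: attr => _ _ _ {2}-> Ax; exists i => //; by exists x.
Qed.

Lemma attr_word w x : A x -> A (word_map w x).
Proof. by move=> Ax; elim: w => //= i w; exact: attr_into. Qed.

Lemma attr_cover x : A x -> exists i y, A y /\ x = g i y.
Proof.
case: attr => _ _ _ {1}-> [i _ [y Ay <-]]; by exists i, y.
Qed.

(** Points of [A] within [r'] of each other fall under [local_contraction]; for the others a uniform
    orbit constant is enough, since [nm (x - y)] exceeds [r']. The second clause concerns points
    outside [A] as well and later locates the periodic points. *)
Lemma attr_contraction : exists2 th : R, 0 < th < 1 & exists2 K : R, 0 < K &
  (forall w x y, A x -> A y ->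
    nm (word_map w x - word_map w y) <= K * th ^+ size w * nm (x - y)) /\
  (forall x y, Om x -> Om y -> exists K : R, forall w,
    nm (word_map w y - word_map w x) <= K * th ^+ size w).
Proof.
have [th th01 [M M0 LC]] := local_contraction G; exists th => //.
have OC := orbit_contraction th01 M0 LC.
have th0 : 0 < th by move: th01 => /andP[].
have thk n : 0 < th ^+ n by rewrite exprn_gt0.
have [r r0 Ar] := compact_in_ball (@ifs_dom_open R G) cA AO.
pose r' := r / 2; have r'0 : 0 < r' by rewrite divr_gt0.
have Ar' x : A x -> in_ball Om x (2 * r') by move=> /Ar; rewrite mulrC divfK.
clearbody r'.
have [x0 Ax0] : A !=set0 by case: attr.
have [|a Aa|n hn] := @compact_uniform R A (fun n y => forall w,
    nm (word_map w y - word_map w x0) <= n%:R * th ^+ size w) cA.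
- move=> n m x nm' H w; apply: le_trans (H w) _.
  by rewrite ler_wpM2r ?ler_nat// ltW.
- have [Ka hKa] := OC x0 a (AO Ax0) (AO Aa).
  have [n hn] := exists_natr_gt (Ka + M).
  exists n; exists r' => // y Ay /ltW ya w.
  apply: (@le_trans _ _ ((Ka + M) * th ^+ size w)); last by rewrite ler_pM2r// ltW.
  apply: le_trans (nmB_trans (word_map w a) _ _) _; rewrite addrC mulrDl lerD//.
  apply: le_trans (LC w a y r' r'0 (Ar' a Aa) ya) _.
  rewrite mulrAC ler_pM2r// mulrAC ler_pdivrMr//.
  by rewrite ler_pM2l.
exists (M / r' + 2 * n%:R / r').
  by apply: ltr_wpDr; [apply: divr_ge0; [exact: mulr_ge0|exact: ltW]|exact: divr_gt0].
split=> // w x y Ax Ay; rewrite mulrDl mulrDl.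
have c0 (u : R) : 0 <= u -> 0 <= u / r' * th ^+ size w * nm (x - y).
  by move=> u0; rewrite !mulr_ge0 ?nm_ge0 ?invr_ge0// ltW.
have [xy|xy] := leP (nm (x - y)) r'.
  apply: le_trans (LC w y x r' r'0 (Ar' y Ay) xy) _.
  by rewrite lerDl c0// mulr_ge0.
rewrite -[leLHS]add0r; apply: lerD; first by rewrite c0 ?ltW.
apply: le_trans (nmB_trans (word_map w x0) _ _) _.
apply: (@le_trans _ _ (2 * n%:R * th ^+ size w)).
  rewrite (_ : 2 * n%:R * _ = n%:R * th ^+ size w + n%:R * th ^+ size w); last by ring.
  by apply: lerD; [exact: hn|rewrite nmBC; exact: hn].
rewrite (_ : 2 * n%:R / r' * _ * _ = 2 * n%:R * th ^+ size w * (nm (x - y) / r')); last by ring.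
apply: ler_peMr; first by apply: mulr_ge0; [exact: mulr_ge0|exact: ltW].
by rewrite ler_pdivlMr// mul1r ltW.
Qed.

Lemma attr_linear i : exists2 r : R, 0 < r & exists2 L : R, 0 < L &
  forall a, A a -> exists2 d, d != 0 & forall e x y, e <= r ->
    nm (x - a) <= e -> nm (y - a) <= e ->
    nm (g i x - g i y - d * (x - y)) <= L * e * nm (x - y).
Proof.
have [M M0 OM] := dom_bounded G.
have [r r0 Ar] := compact_in_ball (@ifs_dom_open R G) cA AO.
have /choice[df dfP] : forall z, exists d, Om z -> cderiv (g i) z d.
  move=> z; have [Oz|Oz] := pselect (Om z); last by exists 0.
  by have [d] := map_cderiv i Oz; exists d.
(* Discs of radius [4 r'] about points within [4 r'] of [A] have to stay in the domain. *)
pose r' := r / 8; have r'0 : 0 < r' by rewrite divr_gt0.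
have rE : r = 8 * r' by rewrite /r' mulrC divfK.
clearbody r'; pose L := (M + M) / (4 * r').
have L0 : 0 < L by rewrite divr_gt0 ?addr_gt0 ?mulr_gt0.
have LP a z : A a -> nm (z - a) <= 4 * r' -> cderiv (g i) z (df z) /\ nm (df z) <= L.
  move=> Aa za; have zr : in_ball Om z (4 * r') by apply: in_ballS (Ar a Aa) _; lra.
  have Oz : Om z by apply: zr; rewrite subrr nm0 mulr_ge0 ?ltW.
  split; first exact: dfP.
  apply: (cauchy_estimate _ _ (dfP z Oz)); first by rewrite mulr_gt0.
    by move=> u /zr Ou; exists (df u); exact: dfP.
  move=> u uz; apply: le_trans (nmD _ _) _; rewrite nmN.
  have Ou : Om u by apply: zr; rewrite uz.
  by apply: lerD; apply: OM; exact: ifs_map_into.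
clearbody L; exists r' => //; exists (2 * L / r'); first by rewrite divr_gt0 ?mulr_gt0.
move=> a Aa; exists (df a).
  have Ball z : nm (z - a) <= 4 * r' -> Om z by move=> za; apply: (Ar a Aa); lra.
  apply: (@injective_deriv_neq0 R (g i) df a r' M r'0).
    move=> z za; have Oz := Ball z za; split; first exact: dfP.
    by apply: OM; exact: ifs_map_into.
  move=> z w /Ball Oz /Ball Ow zw.
  by apply: (@ifs_map_injective R G i) => //; exact: mem_set.
move=> e x y er xa ya; apply: (@almost_linear R (g i) df a y x e) => //.
move=> z za; have [|zd _] := LP a z Aa; first by lra.
split=> //; rewrite nmBC.
have := @deriv_lipschitz R (g i) df a z L r' r'0.
move=> H; apply: le_trans (H _) _; first by move=> u ua; apply: (LP a u Aa); lra.
by rewrite ler_wpM2l// divr_ge0 ?mulr_ge0 ?ltW.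
Qed.

(** At small distances the nonzero derivative gives the bound, at large ones injectivity and
    compactness do. *)
Lemma attr_expand i : exists2 q : R, 0 < q & forall x y, A x -> A y ->
  q * nm (x - y) <= nm (g i x - g i y).
Proof.
have [r r0 [L L0 lin]] := attr_linear i.
have [th /andP[th0 _] [K K0 [contr _]]] := attr_contraction.
have [D0 D00 AD0] := compact_bounded_nm cA.
have [|a Aa|n hn] := @compact_uniform R A (fun n a => forall x, A x ->
    nm (x - a) <= n.+1%:R^-1 -> n.+1%:R^-1 * nm (x - a) <= nm (g i x - g i a)) cA.
- move=> n m a nm' H x Ax xa.
  have mn : m.+1%:R^-1 <= n.+1%:R^-1 :> R by rewrite lef_pV2 ?posrE ?ltr0Sn// ler_nat ltnS.
  apply: le_trans (H x Ax (le_trans xa mn)).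
  by rewrite ler_wpM2r// nm_ge0.
- have [d d0 hd] := lin a Aa; have nd0 : 0 < nm d by rewrite nm_gt0.
  pose e := Num.min r (nm d / 2 / L).
  have e0 : 0 < e by rewrite lt_min r0 !divr_gt0.
  have Le : L * e <= nm d / 2.
    by rewrite mulrC -ler_pdivlMr// /e ge_min lexx orbT.
  have er : e <= r by rewrite ge_min lexx.
  clearbody e.
  have e20 : 0 < Num.min (e / 2) (nm d / 2) by rewrite lt_min !divr_gt0.
  have [n] := exists_natr_inv e20; rewrite le_min => /andP[ne nd].
  exists n; exists (e / 2); first by rewrite divr_gt0.
  move=> y Ay ya x Ax xy.
  have ya' : nm (y - a) <= e by lra.
  have xa' : nm (x - a) <= e.
    by have := nmB_trans y x a; move: xy ne; set u := _^-1; lra.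
  have := hd e x y er xa' ya'; rewrite -(nmN (_ - _ - _)) => h1.
  have := nm_leB (d * (x - y)) (g i x - g i y); rewrite nmM => h2.
  have h3 : L * e * nm (x - y) <= nm d / 2 * nm (x - y) by rewrite ler_wpM2r ?nm_ge0.
  have h4 : n.+1%:R^-1 * nm (x - y) <= nm d / 2 * nm (x - y) by rewrite ler_wpM2r ?nm_ge0.
  apply: le_trans h4 _; move: h1 h2.
  rewrite (_ : d * _ - _ = - (g i x - g i y - d * (x - y))); last by ring.
  lra.
pose eta : R := n.+1%:R^-1; have eta0 : 0 < eta by rewrite invr_gt0 ltr0Sn.
have lip x y : A x -> A y -> nm (g i x - g i y) <= K * th ^+ 1 * nm (x - y).
  by move=> Ax Ay; exact: (contr [:: i]).
have Kt0 : 0 <= K * th ^+ 1 by rewrite ltW// mulr_gt0// exprn_gt0.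
have e2 : eta / 2 < eta by rewrite ltr_pdivrMr// ltr_pMr// ltr1n.
have [|c c0 hc] := compact_separation cA Kt0 e2 lip lip.
  move=> x y Ax Ay xy gxy.
  have : x = y by apply: (@ifs_map_injective R G i) => //; apply: mem_set; exact: AO.
  by move=> xy'; move: xy; rewrite xy' subrr nm0 leNgt divr_gt0.
have D20 : 0 < D0 + D0 by rewrite addr_gt0.
exists (Num.min eta (c / (D0 + D0))); first by rewrite lt_min eta0 divr_gt0.
move=> x y Ax Ay; have [xy|xy] := leP (nm (x - y)) eta.
  apply: le_trans (hn y Ay x Ax xy); rewrite ler_wpM2r ?nm_ge0//.
  by rewrite ge_min lexx.
apply: le_trans (hc x y Ax Ay (ltW xy)).
apply: (@le_trans _ _ (c / (D0 + D0) * nm (x - y))).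
  by rewrite ler_wpM2r ?nm_ge0// ge_min lexx orbT.
rewrite mulrAC ler_pdivrMr// ler_pM2l//.
apply: le_trans (nmD _ _) _; rewrite nmN; apply: lerD; exact: AD0.
Qed.

(** The variation is measured relative to a quotient so that it multiplies well under composition.
    For [d <= r] it comes from [attr_linear]; for larger [d] all quotients have modulus between [q]
    and [K], and a constant of order [1 / r] will do. A natural number as constant lets
    [finite_uniform] treat all letters at once. *)
Lemma attr_quot i : exists n : nat, forall d x y x' y',
  A x -> A y -> A x' -> A y' -> x <> y -> x' <> y' ->
  nm (y - x) <= d -> nm (x' - x) <= d -> nm (y' - x) <= d ->
  nm (quot (g i) x y - quot (g i) x' y') <= n%:R * d * nm (quot (g i) x' y').
Proof.
have [r r0 [L L0 lin]] := attr_linear i.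
have [q q0 expd] := attr_expand i.
have [th /andP[th0 th1] [K K0 [contr _]]] := attr_contraction.
pose c1 := 2 * L / q; pose c2 := 2 * K / (r * q).
have [n hn] := exists_natr_gt (c1 + c2).
have c10 : 0 < c1 by rewrite divr_gt0 ?mulr_gt0.
have c20 : 0 < c2 by rewrite divr_gt0 ?mulr_gt0.
exists n => d x y x' y' Ax Ay Ax' Ay' xy xy' yd xd' yd'.
have d0 : 0 <= d by apply: le_trans yd; exact: nm_ge0.
have qle u v : A u -> A v -> u <> v -> q <= nm (quot (g i) u v).
  by move=> Au Av /nmB_gt0 uv; rewrite nm_div ler_pdivlMr// expd.
have qK u v : A u -> A v -> u <> v -> nm (quot (g i) u v) <= K.
  move=> Au Av /nmB_gt0 uv; rewrite nm_div ler_pdivrMr//.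
  apply: le_trans (contr [:: i] u v Au Av) _; rewrite expr1 ler_wpM2r ?nm_ge0//.
  by rewrite ler_piMr ?ltW.
have Q1 := qle x' y' Ax' Ay' xy'.
apply: (@le_trans _ _ ((c1 + c2) * d * nm (quot (g i) x' y'))); last first.
  by rewrite ler_wpM2r ?nm_ge0// ler_wpM2r// ltW.
have [dr|dr] := leP d r.
  have [u u0 hu] := lin x Ax.
  have est a b : a <> b -> nm (a - x) <= d -> nm (b - x) <= d ->
      nm (quot (g i) a b - u) <= L * d.
    move=> ab ax bx; have ab0 := nmB_gt0 ab.
    have ab1 : a - b != 0 by rewrite -nm_gt0.
    rewrite /quot (_ : _ - u = (g i a - g i b - u * (a - b)) / (a - b)); last by field.
    by rewrite nm_div ler_pdivrMr// hu.
  have e1 : nm (quot (g i) x y - u) <= L * d by apply: est => //; rewrite subrr nm0.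
  have e2 := est x' y' xy' xd' yd'; rewrite nmBC in e2.
  apply: le_trans (nmB_trans u _ _) _.
  apply: (@le_trans _ _ (c1 * d * q)).
    rewrite (_ : c1 * d * q = L * d + L * d); first exact: lerD.
    by rewrite /c1; field; rewrite gt_eqF.
  apply: ler_pM => //; [by rewrite mulr_ge0// ltW|exact: ltW|].
  by rewrite ler_wpM2r// lerDl ltW.
apply: le_trans (nmD _ _) _; rewrite nmN.
apply: (@le_trans _ _ (c2 * r * q)).
  rewrite (_ : c2 * r * q = K + K); first by apply: lerD; exact: qK.
  by rewrite /c2; field; rewrite !gt_eqF.
apply: ler_pM => //; [by rewrite mulr_ge0// ltW|exact: ltW|].
by apply: ler_pM => //; rewrite ?ltW// ltrDr.
Qed.

Lemma attr_sep : strong_separation G A ->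
  exists2 s : R, 0 < s & forall i j x y, i != j -> A x -> A y -> s <= nm (g i x - g j y).
Proof.
move=> ssc; have [th /andP[th0 th1] [K K0 [contr _]]] := attr_contraction.
have lip i x y : A x -> A y -> nm (g i x - g i y) <= K * th ^+ 1 * nm (x - y).
  by move=> Ax Ay; exact: (contr [:: i]).
have Kt0 : 0 <= K * th ^+ 1 by rewrite ltW// mulr_gt0// exprn_gt0.
have [|[i j]|n hn] := @finite_uniform (ifs_index G * ifs_index G)%type
  (fun ij n => forall x y, ij.1 != ij.2 -> A x -> A y -> n.+1%:R^-1 <= nm (g ij.1 x - g ij.2 y)).
- move=> ij n m nm' H x y ij' Ax Ay; apply: le_trans (H x y ij' Ax Ay).
  by rewrite lef_pV2 ?posrE ?ltr0Sn// ler_nat ltnS.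
- rewrite /=; have [->|ij] := eqVneq i j; first by exists 0%N.
  have m21 : -2 < -1 :> R by rewrite ltrN2 ltr1n.
  have [|c c0 hc] := compact_separation cA Kt0 m21 (lip i) (lip j).
    move=> x y Ax Ay _ gxy.
    have : ((g i @` A) `&` (g j @` A)) (g i x) by split; [exists x|exists y].
    by rewrite ssc.
  have [n hn] := exists_natr_inv c0; exists n => x y _ Ax Ay; apply: le_trans hn _.
  by apply: hc => //; apply: le_trans (nm_ge0 _); rewrite lerN10.
exists n.+1%:R^-1; first by rewrite invr_gt0 ltr0Sn.
by move=> i j x y ij; exact: (hn (i, j)).
Qed.

Lemma attr_conf_sys : strong_separation G A ->
  exists K th C1 sg D : R, @conf_sys (ifs_index G) g A K th C1 sg D.
Proof.
move=> ssc; have [s s0 sep] := attr_sep ssc.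
have [th th01 [K K0 [contr _]]] := attr_contraction.
have [D0 D00 AD0] := compact_bounded_nm cA.
have [|n hn] := finite_uniform _ attr_quot.
  move=> i n m nm' H d x y x' y' Ax Ay Ax' Ay' xy xy' yd xd yd'.
  apply: le_trans (H d x y x' y' Ax Ay Ax' Ay' xy xy' yd xd yd') _.
  rewrite ler_wpM2r ?nm_ge0// ler_wpM2r ?ler_nat//.
  by apply: le_trans yd; exact: nm_ge0.
exists K, th, n.+1%:R, s, (D0 + D0); split => //.
- by rewrite addr_gt0.
- by move=> x y Ax Ay; apply: le_trans (nmD _ _) _; rewrite nmN; apply: lerD; exact: AD0.
- by move=> i x; exact: attr_into.
- by move=> x; exact: attr_cover.
- by move=> i x y Ax Ay; apply: (@ifs_map_injective R G i); apply: mem_set; exact: AO.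
- move=> i d x y x' y' Ax Ay Ax' Ay' xy xy' yd xd yd'.
  apply: le_trans (hn i d x y x' y' Ax Ay Ax' Ay' xy xy' yd xd yd') _.
  rewrite ler_wpM2r ?nm_ge0// ler_wpM2r ?ler_nat//.
  by apply: le_trans yd; exact: nm_ge0.
Qed.

End Attractor.

(** * Bounded distortion and separation of pieces *)

Section ConformalSystem.
Variables (R : realType) (I : finType) (g : I -> R[i] -> R[i]) (A : set R[i]).
Local Notation C := (R[i]).
Variables (K th C1 sg D : R).
Hypothesis S : conf_sys g A K th C1 sg D.
Implicit Types (x y z : C) (w u v : seq I).

Let K0 : 0 < K. Proof. exact: cs_K S. Qed.
Let th0 : 0 < th. Proof. by case/andP: (cs_th S). Qed.
Let th1 : th < 1. Proof. by case/andP: (cs_th S). Qed.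
Let C10 : 0 < C1. Proof. exact: cs_C1 S. Qed.
Let D0 : 0 < D. Proof. exact: cs_D S. Qed.
Let sg0 : 0 < sg. Proof. exact: cs_sg S. Qed.

Lemma th_pow_le1 n : th ^+ n <= 1.
Proof. by rewrite exprn_ile1 ?ltW. Qed.

Lemma th_pow_gt0 n : 0 < th ^+ n.
Proof. exact: exprn_gt0. Qed.

Lemma th_pow_small (e : R) : 0 < e -> exists n, forall m, (n <= m)%N -> K * th ^+ m * D < e.
Proof.
move=> e0; have [N _ hN] : \forall n \near \oo, th ^+ n < e / (K * D).
  have : th ^+ n @[n --> \oo] --> (0 : R) by apply: cvg_expr; rewrite gtr0_norm.
  move/cvgrPdist_lt => /(_ (e / (K * D))); rewrite divr_gt0 ?mulr_gt0// => /(_ isT).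
  by apply: filterS => n; rewrite sub0r normrN gtr0_norm ?th_pow_gt0.
exists N => m /hN /=; rewrite ltr_pdivlMr ?mulr_gt0//.
by rewrite (_ : K * th ^+ m * D = th ^+ m * (K * D)); last by ring.
Qed.

Lemma wmap_cat u v z : wmap g (u ++ v) z = wmap g u (wmap g v z).
Proof. by rewrite /wmap foldr_cat. Qed.

Lemma wmap_into w x : A x -> A (wmap g w x).
Proof. by move=> Ax; elim: w => //= i w; exact: (cs_into S). Qed.

Lemma wmap_inj w x y : A x -> A y -> wmap g w x = wmap g w y -> x = y.
Proof.
move=> Ax Ay; elim: w => //= i w IH e; apply: IH.
by apply: (cs_inj S _ _ e); exact: wmap_into.
Qed.

Lemma wmap_neq w x y : A x -> A y -> x <> y -> wmap g w x <> wmap g w y.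
Proof. by move=> Ax Ay xy /(wmap_inj Ax Ay). Qed.

Lemma wmap_dist w x y : A x -> A y -> nm (wmap g w x - wmap g w y) <= K * th ^+ size w * D.
Proof.
move=> Ax Ay; apply: le_trans (cs_contr S w Ax Ay) _.
by rewrite ler_wpM2l ?(cs_diam S)// mulr_ge0 ?ltW ?th_pow_gt0.
Qed.

Lemma quot_comp (f h : C -> C) x y : h x <> h y ->
  quot (fun z => f (h z)) x y = quot f (h x) (h y) * quot h x y.
Proof.
move=> /eqP; rewrite -subr_eq0 => hxy; rewrite /quot.
by rewrite mulrA divfK.
Qed.

Lemma nm_quot (f : C -> C) x y : x <> y -> nm (quot f x y) * nm (x - y) = nm (f x - f y).
Proof. by move=> /nmB_gt0 xy; rewrite nm_div divfK// gt_eqF. Qed.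

Lemma quot_gt0 w x y : A x -> A y -> x <> y -> 0 < nm (quot (wmap g w) x y).
Proof.
move=> Ax Ay xy; rewrite nm_div divr_gt0 ?nmB_gt0//; exact: wmap_neq.
Qed.

Lemma quot_gt0_letter i x y : A x -> A y -> x <> y -> 0 < nm (quot (g i) x y).
Proof. exact: (@quot_gt0 [:: i]). Qed.

Lemma wmap_quot_cat u v x y : A x -> A y -> x <> y ->
  quot (wmap g (u ++ v)) x y = quot (wmap g u) (wmap g v x) (wmap g v y) * quot (wmap g v) x y.
Proof.
move=> Ax Ay xy; rewrite -quot_comp; last exact: wmap_neq.
by rewrite /quot !wmap_cat.
Qed.

Lemma wmap_quot_cons i w x y : A x -> A y -> x <> y ->
  quot (wmap g (i :: w)) x y = quot (g i) (wmap g w x) (wmap g w y) * quot (wmap g w) x y.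
Proof. by move=> Ax Ay xy; rewrite -quot_comp//; exact: wmap_neq. Qed.

Definition cs_B := expR (C1 * K * D / (1 - th)).

Lemma cs_B_gt0 : 0 < cs_B. Proof. exact: expR_gt0. Qed.

Lemma letter_quot_dist (d : R) i w x y x' y' : A x -> A y -> A x' -> A y' ->
  x <> y -> x' <> y' -> 0 <= d ->
  nm (y - x) <= d -> nm (x' - x) <= d -> nm (y' - x) <= d ->
  nm (quot (g i) (wmap g w x) (wmap g w y) - quot (g i) (wmap g w x') (wmap g w y')) <=
    C1 * (K * th ^+ size w * d) * nm (quot (g i) (wmap g w x') (wmap g w y')).
Proof.
move=> Ax Ay Ax' Ay' xy xy' d0 h1 h2 h3.
have kd (a b : C) : A a -> A b -> nm (a - b) <= d -> nm (wmap g w a - wmap g w b) <= K * th ^+ size w * d.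
  move=> Aa Ab ab; apply: le_trans (cs_contr S w Aa Ab) _.
  by rewrite ler_wpM2l// mulr_ge0 ?ltW ?th_pow_gt0.
by apply: (cs_quot S); try exact: wmap_into; try exact: wmap_neq; exact: kd.
Qed.

(* Bounded distortion: [1 + t <= exp t] turns the product over the letters into
   the exponential of a geometric sum. *)
Lemma distortion w x y x' y' : A x -> A y -> A x' -> A y' -> x <> y -> x' <> y' ->
  nm (quot (wmap g w) x y) <= cs_B * nm (quot (wmap g w) x' y').
Proof.
move=> Ax Ay Ax' Ay' xy xy'; pose a := C1 * K * D / (1 - th).
have t1 : 0 < 1 - th by rewrite subr_gt0.
have a0 : 0 < a by rewrite divr_gt0 ?mulr_gt0.
(* The exponent is the partial geometric sum; the bound by the full sum [a] alone does not pass
   through the induction. *)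
suff H : nm (quot (wmap g w) x y) <= expR (a * (1 - th ^+ size w)) * nm (quot (wmap g w) x' y').
  apply: le_trans H _; rewrite ler_wpM2r ?nm_ge0// ler_expR ler_piMr ?ltW//.
  by rewrite gtrBl th_pow_gt0.
elim: w => [|i w IH].
  rewrite /= expr0 subrr mulr0 expR0 mul1r /quot /=.
  rewrite !divff ?subr_eq0//; exact/eqP.
rewrite !wmap_quot_cons// (nmM (quot (g i) _ _)) (nmM (quot (g i) _ _)).
have -> : expR (a * (1 - th ^+ size (i :: w))) =
    expR (C1 * (K * th ^+ size w * D)) * expR (a * (1 - th ^+ size w)).
  by rewrite -expRD /a exprS; congr expR; field; rewrite gt_eqF.
rewrite mulrACA; apply: ler_pM => //; rewrite ?nm_ge0//.
have dd (b c : C) : A b -> A c -> nm (b - c) <= D by exact: (cs_diam S).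
have L := letter_quot_dist i w Ax Ay Ax' Ay' xy xy' (ltW D0) (dd _ _ Ay Ax) (dd _ _ Ax' Ax) (dd _ _ Ay' Ax).
apply: le_trans (nm_leB _ (quot (g i) (wmap g w x') (wmap g w y'))) _.
apply: le_trans (lerD (lexx _) L) _; rewrite -[X in X + _]mul1r -mulrDl.
by rewrite ler_wpM2r ?nm_ge0//; exact: expR_ge1Dx.
Qed.

Definition cs_C3 := cs_B * C1 * K / (1 - th).

Lemma cs_C3_gt0 : 0 < cs_C3.
Proof. by rewrite divr_gt0 ?subr_gt0 ?mulr_gt0// cs_B_gt0. Qed.

(** The product over the letters is telescoped: one factor varies relatively by [C1 K th ^+ k d],
    the product of the inner letters is compared by [distortion], and the geometric sum keeps the
    constant independent of the word. *)
Lemma word_quot_dist (d : R) w x y x' y' : A x -> A y -> A x' -> A y' ->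
  x <> y -> x' <> y' ->
  nm (y - x) <= d -> nm (x' - x) <= d -> nm (y' - x) <= d ->
  nm (quot (wmap g w) x y - quot (wmap g w) x' y') <= cs_C3 * d * nm (quot (wmap g w) x' y').
Proof.
move=> Ax Ay Ax' Ay' xy xy' h1 h2 h3.
have d0 : 0 <= d by apply: le_trans h1; exact: nm_ge0.
have t1 : 0 < 1 - th by rewrite subr_gt0.
suff H : nm (quot (wmap g w) x y - quot (wmap g w) x' y') <=
    cs_C3 * (1 - th ^+ size w) * d * nm (quot (wmap g w) x' y').
  apply: le_trans H _; rewrite ler_wpM2r ?nm_ge0// ler_wpM2r//.
  by rewrite ler_piMr ?ltW ?cs_C3_gt0// gtrBl th_pow_gt0.
elim: w => [|i w IH].
  rewrite /= expr0 subrr mulr0 !mul0r /quot /=.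
  rewrite !divff ?subr_eq0; try exact/eqP.
  by rewrite subrr nm0.
rewrite !wmap_quot_cons//; have L := letter_quot_dist i w Ax Ay Ax' Ay' xy xy' d0 h1 h2 h3.
have Dt := distortion w Ax Ay Ax' Ay' xy xy'.
move: IH L Dt; set q := quot (g i) _ _; set q' := quot (g i) _ _.
set p := quot (wmap g w) _ _; set p' := quot (wmap g w) _ _ => IH L Dt.
rewrite (_ : q * p - q' * p' = (q - q') * p + q' * (p - p')); last by ring.
clearbody q q' p p'; apply: le_trans (nmD _ _) _; rewrite !nmM.
have e1 : nm (q - q') * nm p <= C1 * (K * th ^+ size w * d) * nm q' * (cs_B * nm p').
  by apply: ler_pM => //; exact: nm_ge0.
have e2 : nm q' * nm (p - p') <= nm q' * (cs_C3 * (1 - th ^+ size w) * d * nm p').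
  by rewrite ler_wpM2l ?nm_ge0.
apply: le_trans (lerD e1 e2) _; rewrite le_eqVlt; apply/orP; left; apply/eqP.
by rewrite exprS /cs_C3; field; rewrite gt_eqF.
Qed.

(** * Sizes of pieces and their isolation *)

Section Scale.
Variables (x0 y0 : C).
Hypotheses (Ax0 : A x0) (Ay0 : A y0) (xy0 : x0 <> y0).

(** The size of the piece [wmap g w A], read off at one reference pair; by [distortion] any other
    pair of points gives the same value up to a factor [cs_B]. *)
Definition scale w := nm (quot (wmap g w) x0 y0).

Lemma scale_gt0 w : 0 < scale w.
Proof. exact: quot_gt0. Qed.

Lemma scale_nil : scale [::] = 1.
Proof. by rewrite /scale /quot /= divff ?nm1// subr_eq0; exact/eqP. Qed.

Lemma scale_le w : scale w <= K * th ^+ size w.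
Proof. by rewrite /scale nm_div ler_pdivrMr ?nmB_gt0// (cs_contr S). Qed.

Lemma scale_leK w : scale w <= K.
Proof.
by apply: le_trans (scale_le w) _; rewrite ler_piMr ?th_pow_le1// ltW.
Qed.

Lemma dist_le_scale w x y : A x -> A y ->
  nm (wmap g w x - wmap g w y) <= cs_B * scale w * nm (x - y).
Proof.
move=> Ax Ay; have [->|/eqP xy] := eqVneq x y; first by rewrite !subrr nm0 mulr0.
by rewrite -nm_quot// ler_wpM2r ?nm_ge0// distortion.
Qed.

Lemma scale_le_dist w x y : A x -> A y ->
  scale w * nm (x - y) <= cs_B * nm (wmap g w x - wmap g w y).
Proof.
move=> Ax Ay; have [->|/eqP xy] := eqVneq x y; first by rewrite !subrr nm0 !mulr0.
by rewrite -(nm_quot _ xy) mulrA ler_wpM2r ?nm_ge0// distortion.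
Qed.

Lemma scale_cat u v : scale (u ++ v) <= cs_B * scale u * scale v.
Proof.
rewrite {1}/scale wmap_quot_cat// nmM ler_wpM2r ?nm_ge0//.
by apply: distortion => //; [exact: wmap_into|exact: wmap_into|exact: wmap_neq].
Qed.

(** Makes stopping along an itinerary effective: the first piece below a threshold is not much
    smaller than the threshold. *)
Lemma scale_rcons : exists2 c2 : R, 0 < c2 & forall w i, scale w <= c2 * scale (rcons w i).
Proof.
have [|i|n hn] := @finite_uniform I (fun i n => n.+1%:R^-1 <= nm (quot (g i) x0 y0)).
- move=> i n m nm'; apply: le_trans.
  by rewrite lef_pV2 ?posrE ?ltr0Sn// ler_nat ltnS.
- by apply: exists_natr_inv; exact: quot_gt0_letter.
exists (cs_B * n.+1%:R); first by rewrite mulr_gt0 ?cs_B_gt0.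
move=> w i; rewrite -cats1 {2}/scale wmap_quot_cat// nmM.
have d1 := @distortion w x0 y0 (wmap g [:: i] x0) (wmap g [:: i] y0) Ax0 Ay0
  (wmap_into [:: i] Ax0) (wmap_into [:: i] Ay0) xy0 (wmap_neq Ax0 Ay0 xy0).
apply: le_trans d1 _; rewrite -mulrA ler_pM2l ?cs_B_gt0// mulrCA ler_peMr ?nm_ge0//.
have := hn i; rewrite -[_^-1]div1r ler_pdivrMr ?ltr0Sn// mulrC.
by [].
Qed.

(** [i] is the first letter of [w] from which an itinerary of [y] departs. *)
Lemma not_in_piece w y : A y -> ~ (exists2 y1, A y1 & y = wmap g w y1) ->
  exists u i v j y1, [/\ w = u ++ i :: v, j != i, A y1 & y = wmap g u (g j y1)].
Proof.
elim: w y => [|i w IH] y Ay ny; first by case: ny; exists y.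
have [j [y1 [Ay1 yj]]] := cs_cover S Ay.
have [ij|ij] := eqVneq j i; last by exists [::], i, w, j, y1.
have [|u [i' [v [j' [y2 [-> ji Ay2 y1E]]]]]] := IH y1 Ay1.
  by move=> [y2 Ay2 y1E]; apply: ny; exists y2 => //; rewrite yj ij y1E.
by exists (i :: u), i', v, j', y2; split => //; rewrite yj ij y1E.
Qed.

Definition cs_kappa := sg / (cs_B * cs_B * K).

Lemma cs_kappa_gt0 : 0 < cs_kappa.
Proof. by rewrite divr_gt0 ?mulr_gt0// cs_B_gt0. Qed.

(** Where the itinerary of [y] leaves [w], after a prefix [u], the two points are [sg] apart.
    Applying [wmap g u] multiplies this distance by about [scale u], and [scale w] is at most
    [cs_B * K] times [scale u]. *)
Lemma isolation w x y : A x -> A y -> ~ (exists2 y1, A y1 & y = wmap g w y1) ->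
  cs_kappa * scale w <= nm (wmap g w x - y).
Proof.
move=> Ax Ay /(not_in_piece Ay)[u [i [v [j [y1 [wE ji Ay1 ->]]]]]].
rewrite wE wmap_cat /=.
have Agx : A (g i (wmap g v x)) by apply: (cs_into S); exact: wmap_into.
have Agy : A (g j y1) by exact: (cs_into S).
have h1 := scale_le_dist u Agx Agy.
have h2 : sg <= nm (g i (wmap g v x) - g j y1).
  by apply: (cs_sep S) => //; [rewrite eq_sym|exact: wmap_into].
have h3 : scale (u ++ i :: v) <= cs_B * scale u * K.
  apply: le_trans (scale_cat _ _) _; rewrite ler_wpM2l ?scale_leK//.
  by rewrite mulr_ge0 ?ltW ?cs_B_gt0 ?scale_gt0.
have h4 : scale u * sg <= cs_B * nm (wmap g u (g i (wmap g v x)) - wmap g u (g j y1)).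
  by apply: le_trans h1; rewrite ler_wpM2l// ltW// scale_gt0.
rewrite /cs_kappa -(ler_pM2l cs_B_gt0); apply: le_trans h4.
apply: (@le_trans _ _ (cs_B * (sg / (cs_B * cs_B * K) * (cs_B * scale u * K)))).
  rewrite ler_pM2l ?cs_B_gt0// ler_wpM2l//.
  by rewrite ltW// divr_gt0 ?mulr_gt0// cs_B_gt0.
rewrite le_eqVlt; apply/orP; left; apply/eqP.
by field; rewrite !gt_eqF// cs_B_gt0.
Qed.

End Scale.

(** * Itineraries, finite nets and the absence of isolated points *)

Section Itinerary.
Variable tau : C -> I * C.
Hypothesis tauP : forall x, A x -> A (tau x).2 /\ x = g (tau x).1 (tau x).2.

(** [tau] is an inverse branch of the system on [A]: [tail] is the orbit under the resulting
    expanding map, and [code] lists the letters met on the way. *)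
Definition tail n x := iter n (fun z => (tau z).2) x.

Fixpoint code n x : seq I := if n is n'.+1 then (tau x).1 :: code n' (tau x).2 else [::].

Lemma tail_into n x : A x -> A (tail n x).
Proof. by move=> Ax; elim: n => //= n /tauP[]. Qed.

Lemma size_code n x : size (code n x) = n.
Proof. by elim: n x => //= n IH x; rewrite IH. Qed.

Lemma code_tail n x : A x -> wmap g (code n x) (tail n x) = x.
Proof.
elim: n x => // n IH x Ax; have [At xE] := tauP Ax.
by rewrite /tail iterSr /= IH.
Qed.

Lemma code_rcons n x : code n.+1 x = rcons (code n x) (tau (tail n x)).1.
Proof.
elim: n x => // n IH x; rewrite [LHS]/= -/(code n.+1 _) IH /=.
by rewrite /tail -iterSr.
Qed.

End Itinerary.

Lemma itinerary_exists : A !=set0 ->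
  exists tau : C -> I * C, forall x, A x -> A (tau x).2 /\ x = g (tau x).1 (tau x).2.
Proof.
move=> [x0 Ax0]; have [i0 _] := cs_cover S Ax0.
have /choice[tau tauP] : forall x, exists p : I * C, A x -> A p.2 /\ x = g p.1 p.2.
  move=> x; have [Ax|nAx] := pselect (A x); last by exists (i0, x0).
  by have [i [y [Ay xE]]] := cs_cover S Ax; exists (i, y).
by exists tau.
Qed.

(** Compactness is not among the data of [conf_sys]; the net consists of the images of one point
    under all words of a fixed length. *)
Lemma finite_net (e : R) : A !=set0 -> 0 < e -> exists s : seq C,
  (forall a, a \in s -> A a) /\ forall x, A x -> exists2 a, a \in s & nm (x - a) <= e.
Proof.
move=> A0 e0; have [tau tauP] := itinerary_exists A0; have [x0 Ax0] := A0.
have [n hn] := th_pow_small e0.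
exists [seq wmap g (tval t) x0 | t <- enum {: n.-tuple I}]; split.
  by move=> a /mapP[t _ ->]; exact: wmap_into.
move=> x Ax; exists (wmap g (code tau n x) x0).
  apply/mapP; exists (Tuple (introT eqP (size_code tau n x))) => //.
  by rewrite mem_enum.
rewrite -{1}(code_tail tauP n Ax).
apply: le_trans (wmap_dist _ (tail_into tauP n Ax) Ax0) _.
by rewrite size_code; apply: ltW; exact: hn.
Qed.

(** The piece of rank [n] around [a] is small and, [wmap] being injective on [A], contains a second
    point. *)
Lemma no_isolated (e : R) a : (exists x y, [/\ A x, A y & x <> y]) -> 0 < e -> A a ->
  exists b, [/\ A b, b <> a & nm (b - a) <= e].
Proof.
move=> [x0 [y0 [Ax0 Ay0 xy0]]] e0 Aa.
have [tau tauP] : exists tau : C -> I * C, forall x, A x -> A (tau x).2 /\ x = g (tau x).1 (tau x).2.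
  by apply: itinerary_exists; exists a.
have [n hn] := th_pow_small e0.
have [z Az zt] : exists2 z, A z & z <> tail tau n a.
  have [xt|/eqP xt] := eqVneq x0 (tail tau n a); last by exists x0.
  by exists y0 => //; rewrite -xt; exact/nesym.
exists (wmap g (code tau n a) z); split; first exact: wmap_into.
  rewrite -[X in _ <> X](code_tail tauP n Aa); apply: wmap_neq => //.
  exact: tail_into.
rewrite -[X in _ - X](code_tail tauP n Aa).
apply: le_trans (wmap_dist _ Az (tail_into tauP n Aa)) _.
by rewrite size_code; apply: ltW; exact: hn.
Qed.

End ConformalSystem.

(** * Rigidity *)

Section Rigidity.
Variables (R : realType) (I : finType) (g : I -> R[i] -> R[i]) (A : set R[i]).
Local Notation C := (R[i]).
Variables (K th C1 sg D : R).
Hypothesis S : conf_sys g A K th C1 sg D.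
Hypothesis A2 : exists x y, [/\ A x, A y & x <> y].

Lemma nat_bounded_absurd (a b : R) : 0 < a -> (forall k : nat, k%:R * a <= b) -> False.
Proof.
move=> a0 H; have [k hk] := exists_natr_gt (b / a); have := H k.
by rewrite leNgt -ltr_pdivrMr// hk.
Qed.

(* With [psi = h^-1 k], some piece [g_w A] has size comparable to the
   displacement [psi z0 - z0], and [psi] maps that piece to itself; there [psi]
   is nearly a translation, so its iterates would leave every bounded set. *)
Lemma rigidity (b : R) : 0 < b -> exists2 del : R, 0 < del & forall h k : C -> C,
  (forall x y, A x -> A y -> nm (x - y) <= b * nm (h x - h y)) ->
  (forall x y, A x -> A y -> nm (h x - h y) <= b * nm (x - y)) ->
  (forall x, A x -> exists2 y, A y & k x = h y) ->
  (forall x, A x -> nm (k x - h x) <= del) ->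
  (forall x y, A x -> A y -> nm ((k x - h x) - (k y - h y)) <= del * nm (x - y)) ->
  forall x, A x -> k x = h x.
Proof.
move=> b0; have [x0 [y0 [Ax0 Ay0 xy0]]] := A2.
have A0 : A !=set0 by exists x0.
have [tau tauP] := itinerary_exists S A0.
pose s := scale g x0 y0; pose B := cs_B K th C1 D; pose kap := cs_kappa K th C1 sg D.
have B0 : 0 < B := cs_B_gt0 K th C1 D.
have D0 : 0 < D := cs_D S.
have kap0 : 0 < kap := cs_kappa_gt0 S.
have s0 w : 0 < s w := scale_gt0 S Ax0 Ay0 xy0 w.
have [c2 c20 hc2] := scale_rcons S Ax0 Ay0 xy0.
have dist w x y : A x -> A y -> nm (wmap g w x - wmap g w y) <= B * s w * D.
  move=> Ax Ay; apply: le_trans (dist_le_scale S Ax0 Ay0 xy0 w Ax Ay) _.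
  by rewrite ler_wpM2l ?(cs_diam S)// mulr_ge0// ltW.
have iso := isolation S Ax0 Ay0 xy0; rewrite -/kap -/s in iso.
have snil : s [::] = 1 := scale_nil g xy0.
have sle w : s w <= K * th ^+ size w := scale_le S Ax0 Ay0 xy0 w.
rewrite -/s in hc2; clearbody s B kap.
(* By [c] and [d2] the two terms bounding the displacement of [psi] on the piece stay below its
   isolation [kap * s w]. By [d1] the displacement at [z0] is below [c], so the empty word is not
   selected. By [d3] the variation of [k - h] on the piece is at most half of the lower bound for
   its value at [z0]. *)
pose c := kap / (4 * b ^+ 2).
have c0 : 0 < c by rewrite divr_gt0// mulr_gt0// exprn_gt0.
pose d1 := c / (2 * b); pose d2 := kap / (4 * b * B * D); pose d3 := c / (2 * c2 * b * B * D).
have d10 : 0 < d1 by rewrite divr_gt0// mulr_gt0.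
have d20 : 0 < d2 by rewrite divr_gt0// !mulr_gt0.
have d30 : 0 < d3 by rewrite divr_gt0// !mulr_gt0.
exists (Num.min d1 (Num.min d2 d3)); first by rewrite !lt_min d10 d20.
set del := Num.min _ _.
have del1 : del <= d1 by rewrite ge_min lexx.
have del2 : del <= d2 by rewrite !ge_min lexx orbT.
have del3 : del <= d3 by rewrite !ge_min lexx !orbT.
have del0 : 0 < del by rewrite !lt_min d10 d20.
clearbody del => h k hlow hup kh ksup klip.
have /choice[psi psiP] : forall x, exists y, A x -> A y /\ h y = k x.
  move=> x; have [Ax|nAx] := pselect (A x); last by exists x.
  by have [y Ay kxy] := kh x Ax; exists y.
suff fix_psi x : A x -> psi x = x.
  by move=> x Ax; have [_ <-] := psiP x Ax; rewrite fix_psi.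
move=> Az; apply/eqP; apply: contraT => /eqP pz; exfalso.
move: x Az pz => z0 Az0 pz.
pose e z := k z - h z.
have [Apz0 hpz0] := psiP z0 Az0.
pose t := nm (psi z0 - z0); have t0 : 0 < t by exact: nmB_gt0.
have te : t <= b * nm (e z0) by rewrite /e -hpz0; exact: hlow.
have et : nm (e z0) <= b * t by rewrite /e -hpz0; exact: hup.
have tc : t < c.
  apply: (@le_lt_trans _ _ (b * d1)).
    apply: le_trans te _; rewrite ler_pM2l//; apply: le_trans del1; exact: ksup.
  by rewrite /d1 (_ : b * _ = c / 2); [rewrite ltr_pdivrMr// ltr_pMr// ltr1n|field; rewrite gt_eqF].
have ex : exists n, c * s (code tau n z0) <= t.
  have t1 : 0 < t / c * D by rewrite mulr_gt0// divr_gt0.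
  have [n hn] := th_pow_small S t1; exists n; rewrite mulrC -ler_pdivlMr//.
  apply: le_trans (sle _) _; rewrite size_code ltW//.
  by rewrite -(ltr_pM2r D0); exact: hn.
(* [p] is the last level before [c * s] drops to [t]; there [t] and the size of the piece are
   comparable. *)
case: (ex_minnP ex) => -[|p] hp pmin; first by move: hp; rewrite /= snil mulr1 leNgt tc.
have tp : t < c * s (code tau p z0).
  by rewrite ltNge; apply/negP => /pmin; rewrite ltnn.
pose w := code tau p z0; rewrite -/w in tp.
have tw : c / c2 * s w <= t.
  apply: le_trans hp; rewrite code_rcons -/w mulrAC -mulrA ler_pM2l//.
  by rewrite ler_pdivrMr// mulrC hc2.
pose E := B * s w * D.
have E0 : 0 < E by rewrite !mulr_gt0.
pose pc z := exists2 z1, A z1 & z = wmap g w z1.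
have pcA z : pc z -> A z by move=> [z1 Az1 ->]; exact: (wmap_into S).
have pc0 : pc z0.
  by exists (tail tau p z0); [exact: (tail_into tauP)|rewrite (code_tail tauP)].
have pcd z z' : pc z -> pc z' -> nm (z - z') <= E.
  by move=> [u Au ->] [v Av ->]; exact: dist.
have ez z : pc z -> nm (e z - e z0) <= del * E.
  move=> pz1; apply: le_trans (klip _ _ (pcA z pz1) Az0) _.
  by rewrite ler_pM2l// pcd.
(* On the piece the displacement of [psi] is smaller than the distance to the rest of [A]. *)
have pcpsi z : pc z -> pc (psi z).
  move=> pz1; have Az := pcA z pz1; have [Apsi hpsi] := psiP z Az.
  apply: contrapT => npc; have [z1 Az1 zE] := pz1.
  have := iso w z1 (psi z) Az1 Apsi npc; rewrite -zE.
  apply/negP; rewrite -ltNge nmBC.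
  apply: le_lt_trans (hlow _ _ Apsi Az) _; rewrite hpsi -/(e z).
  have h1 : nm (e z) <= b * t + del * E.
    by apply: le_trans (nm_leB _ (e z0)) _; apply: lerD => //; exact: ez.
  have h2 : b * (b * t) < kap / 4 * s w.
    rewrite mulrA (_ : kap / 4 * s w = b * b * (c * s w)).
      by rewrite ltr_pM2l// mulr_gt0.
    by rewrite /c; field; rewrite gt_eqF.
  have h3 : b * (del * E) <= kap / 4 * s w.
    rewrite (_ : kap / 4 * s w = b * (d2 * E)).
      by rewrite ler_pM2l// ler_pM2r.
    by rewrite /d2 /E; field; rewrite !gt_eqF.
  apply: (@le_lt_trans _ _ (b * (b * t + del * E))); first by rewrite ler_pM2l.
  have : 0 < kap * s w by rewrite mulr_gt0.
  by rewrite mulrDr; lra.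
pose zn n := iter n psi z0.
have pcn n : pc (zn n) by elim: n => //= n; exact: pcpsi.
(* Since [h (psi z) = k z], each application of [psi] moves [h] by [e z], which on the piece is
   nearly the constant vector [e z0]. *)
have drift n : nm (h (zn n) - h z0 - n%:R * e z0) <= n%:R * (del * E).
  elim: n => [|n IH]; first by rewrite /= subrr !mul0r subr0 nm0.
  have [_ hE] := psiP (zn n) (pcA _ (pcn n)).
  rewrite [zn n.+1]/= -/(zn n) hE.
  rewrite (_ : _ - _ - _ = (h (zn n) - h z0 - n%:R * e z0) + (e (zn n) - e z0)); last first.
    by rewrite /e -natr1; ring.
  apply: le_trans (nmD _ _) _; rewrite -natr1 mulrDl mul1r lerD// ez//.
apply: (@nat_bounded_absurd (c / (2 * c2 * b) * s w) (b * E)).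
  by rewrite mulr_gt0// divr_gt0// !mulr_gt0.
move=> n.
have h1 : nm (h (zn n) - h z0) <= b * E.
  apply: le_trans (hup _ _ (pcA _ (pcn n)) Az0) _; rewrite ler_pM2l//.
  exact: pcd.
have h2 : n%:R * nm (e z0) <= n%:R * (del * E) + b * E.
  rewrite -nm_nat -nmM; apply: le_trans (nm_leB _ (h (zn n) - h z0)) _.
  by rewrite addrC nmBC nm_nat lerD.
have h3 : c / (c2 * b) * s w <= nm (e z0).
  rewrite -(ler_pM2l b0); apply: le_trans te; apply: le_trans tw.
  by rewrite le_eqVlt; apply/orP; left; apply/eqP; field; rewrite !gt_eqF.
have h4 : del * E <= c / (2 * c2 * b) * s w.
  rewrite (_ : c / (2 * c2 * b) * s w = d3 * E); first by rewrite ler_pM2r.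
  by rewrite /d3 /E; field; rewrite !gt_eqF.
have h5 : n%:R * (c / (c2 * b) * s w) <= n%:R * nm (e z0) by rewrite ler_wpM2l.
have h6 : n%:R * (del * E) <= n%:R * (c / (2 * c2 * b) * s w) by rewrite ler_wpM2l.
have h7 : n%:R * (c / (c2 * b) * s w) = 2 * (n%:R * (c / (2 * c2 * b) * s w)).
  by field; rewrite !gt_eqF.
lra.
Qed.

End Rigidity.

(** * Finite control of quasi-affine maps, and a pigeonhole principle *)

Section Closeness.
Variables (R : realType) (I : finType) (g : I -> R[i] -> R[i]) (A : set R[i]).
Local Notation C := (R[i]).
Variables (K th C1 sg D : R).
Hypothesis S : conf_sys g A K th C1 sg D.
Hypothesis A2 : exists x y, [/\ A x, A y & x <> y].

Definition quasi_affine (c : R) (h : C -> C) := forall d x y x' y',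
  A x -> A y -> A x' -> A y' -> x <> y -> x' <> y' ->
  nm (y - x) <= d -> nm (x' - x) <= d -> nm (y' - x) <= d ->
  nm (quot h x y - quot h x' y') <= c * d.

Lemma seq_lower_bound (s : seq C) (f : C -> R) : (forall a, a \in s -> 0 < f a) ->
  exists2 m : R, 0 < m & forall a, a \in s -> m <= f a.
Proof.
elim: s => [|a s IH] H; first by exists 1.
have [|m m0 hm] := IH; first by move=> b bs; apply: H; rewrite inE bs orbT.
exists (Num.min m (f a)); first by rewrite lt_min m0 H// inE eqxx.
move=> b; rewrite inE => /orP[/eqP ->|/hm]; rewrite ge_min; first by rewrite lexx orbT.
by move=> ->.
Qed.

(** An Arzela-Ascoli argument in [C^1] form. Besides a net, [s] contains one neighbour of every net
    point, so closeness on [s] controls a difference quotient of [k - h] near each point of [A];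
    quasi-affinity carries this to all close pairs, and the sup bound settles the distant ones. *)
Lemma close_on_net (c del : R) : 0 < c -> 0 < del -> exists s : seq C, exists2 e : R, 0 < e &
  (forall a, a \in s -> A a) /\ forall h k, quasi_affine c h -> quasi_affine c k ->
  (forall a, a \in s -> nm (k a - h a) <= e) ->
  (forall x, A x -> nm (k x - h x) <= del) /\
  (forall x y, A x -> A y -> nm ((k x - h x) - (k y - h y)) <= del * nm (x - y)).
Proof.
(* The sup bound will be [6 c eta^2]; two of them give [12 c eta^2 <= del * eta], enough for pairs
   farther apart than [eta]. *)
move=> c0 del0; pose eta := Num.min 1 (del / (12 * c)).
have eta0 : 0 < eta by rewrite lt_min ltr01 divr_gt0// mulr_gt0.
have eta1 : eta <= 1 by rewrite ge_min lexx.
have etad : 12 * c * eta <= del by rewrite mulrC -ler_pdivlMr ?mulr_gt0// ge_min lexx orbT.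
clearbody eta.
have A0 : A !=set0 by have [x [y [Ax _ _]]] := A2; exists x.
have [s [sA snet]] := finite_net S A0 eta0.
have /choice[f fP] : forall a, exists b, A a -> [/\ A b, b <> a & nm (b - a) <= eta].
  move=> a; have [Aa|nAa] := pselect (A a); last by exists a.
  by have [b hb] := no_isolated S A2 eta0 Aa; exists b.
have [m m0 hm] := @seq_lower_bound s (fun a => nm (f a - a)) (fun a sa =>
  let: And3 _ h _ := fP a (sA a sa) in nmB_gt0 h).
(* Errors of [c eta m / 2] at a net point and at its neighbour, at least [m] away, make a quotient
   of at most [c eta]. *)
exists (s ++ map f s), (Num.min (c * eta * m / 2) (c * eta * eta)).
  by rewrite lt_min !divr_gt0 ?mulr_gt0.
split.
  move=> a; rewrite mem_cat => /orP[/sA//|/mapP[b sb ->]].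
  by have [] := fP b (sA b sb).
move=> h k qh qk close; pose e z := k z - h z.
have quot_e x y : quot e x y = quot k x y - quot h x y.
  by rewrite /quot /e -mulrBl; congr (_ / _); ring.
have near x y : A x -> A y -> x <> y -> nm (x - y) <= eta -> nm (quot e x y) <= 5 * c * eta.
  move=> Ax Ay xy xye; have [a sa xa] := snet x Ax; have Aa := sA a sa.
  have [Ab ba bae] := fP a Aa; set b := f a in Ab ba bae.
  have q1 : nm (quot e a b) <= c * eta.
    rewrite nm_div ler_pdivrMr; last by apply: nmB_gt0 => /esym.
    apply: le_trans (nmD _ _) _; rewrite nmN.
    have e1 : nm (e a) <= c * eta * m / 2.
      have : nm (e a) <= Num.min (c * eta * m / 2) (c * eta * eta).
        by apply: close; rewrite mem_cat sa.
      by rewrite le_min => /andP[].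
    have e2 : nm (e b) <= c * eta * m / 2.
      have : nm (e b) <= Num.min (c * eta * m / 2) (c * eta * eta).
        by apply: close; rewrite mem_cat map_f ?orbT.
      by rewrite le_min => /andP[].
    have : c * eta * m <= c * eta * nm (a - b).
      by rewrite ler_pM2l ?mulr_gt0// nmBC hm.
    lra.
  have d1 : nm (y - x) <= 2 * eta by rewrite nmBC; lra.
  have d2 : nm (a - x) <= 2 * eta by rewrite nmBC; lra.
  have d3 : nm (b - x) <= 2 * eta.
    by apply: le_trans (nmB_trans a _ _) _; rewrite (nmBC a); lra.
  have ab : a <> b by move=> /esym.
  have hq := qh _ _ _ _ _ Ax Ay Aa Ab xy ab d1 d2 d3.
  have kq := qk _ _ _ _ _ Ax Ay Aa Ab xy ab d1 d2 d3.
  apply: le_trans (nm_leB _ (quot e a b)) _; rewrite !quot_e.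
  rewrite (_ : _ - _ - (_ - _) = (quot k x y - quot k a b) - (quot h x y - quot h a b)); last by ring.
  apply: le_trans (lerD (lexx _) (nmD _ _)) _; rewrite nmN -quot_e; lra.
have near' x y : A x -> A y -> nm (x - y) <= eta -> nm (e x - e y) <= 5 * c * eta * nm (x - y).
  move=> Ax Ay xye; have [->|/eqP xy] := eqVneq x y; first by rewrite !subrr nm0 mulr0.
  by rewrite -(nm_quot e xy) ler_wpM2r ?nm_ge0// near.
have sup x : A x -> nm (e x) <= 6 * c * eta * eta.
  move=> Ax; have [a sa xa] := snet x Ax; have Aa := sA a sa.
  apply: le_trans (nm_leB _ (e a)) _.
  have e1 : nm (e a) <= c * eta * eta.
    have : nm (e a) <= Num.min (c * eta * m / 2) (c * eta * eta).
      by apply: close; rewrite mem_cat sa.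
    by rewrite le_min => /andP[].
  have := near' x a Ax Aa xa.
  have : 5 * c * eta * nm (x - a) <= 5 * c * eta * eta by rewrite ler_wpM2l// !mulr_ge0// ltW.
  lra.
have ce0 : 0 < c * eta by rewrite mulr_gt0.
split=> [x Ax|x y Ax Ay].
  apply: le_trans (sup x Ax) _.
  have : 6 * c * eta * eta <= 6 * c * eta * 1 by rewrite ler_wpM2l// -mulrA mulr_ge0// ltW.
  lra.
have [xy|xy] := leP (nm (x - y)) eta.
  apply: le_trans (near' x y Ax Ay xy) _; rewrite ler_wpM2r ?nm_ge0//; lra.
apply: le_trans (nmD _ _) _; rewrite nmN.
apply: le_trans (lerD (sup x Ax) (sup y Ay)) _.
have h1 : 12 * c * eta * eta <= del * eta by rewrite ler_wpM2r// ltW.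
have h2 : del * eta <= del * nm (x - y) by rewrite ler_wpM2l// ltW.
lra.
Qed.

(** The values [m p] may repeat, so the pigeonhole is applied along the sequence [s], on which they
    increase strictly. *)
Lemma infinite_pigeonhole (T : finType) (f : nat -> T) (m : nat -> nat) :
  (forall p, p <= m p)%N -> exists p q, f p = f q /\ (m p < m q)%N.
Proof.
move=> pm; apply: contrapT => H.
pose s n := iter n (fun p => (m p).+1) 0%N.
have sm n k : (m (s n) < s (n + k.+1))%N.
  elim: k => [|k IH]; first by rewrite addn1.
  rewrite addnS; apply: (leq_trans IH); rewrite [s (_.+1)]/= -/(s _).
  by apply: leqW; exact: pm.
have inj : injective (fun i : 'I_(#|T|.+1) => f (s i)).
  suff lt_absurd (a b : nat) : (a < b)%N -> f (s a) <> f (s b).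
    move=> a b fab; case: (ltngtP (nat_of_ord a) b) => [ab|ba|]; last exact: val_inj.
      by case: (lt_absurd _ _ ab).
    by case: (lt_absurd _ _ ba).
  move=> ab fab; apply: H; exists (s a), (s b); split => //.
  apply: leq_trans (pm (s b)).
  by have := sm a (b - a.+1)%N; rewrite -addSnnS subnKC.
by have := leq_card _ inj; rewrite card_ord ltnn.
Qed.

End Closeness.

(** * Two systems on the same attractor *)

Section Comparison.
Variables (R : realType) (A : set R[i]).
Local Notation C := (R[i]).
Variables (I J : finType) (g : I -> C -> C) (f : J -> C -> C).
Variables (K th C1 sg D K' th' C1' sg' D' : R).
Hypothesis S : conf_sys g A K th C1 sg D.
Hypothesis S' : conf_sys f A K' th' C1' sg' D'.
Variables (x0 y0 : C).
Hypotheses (Ax0 : A x0) (Ay0 : A y0) (xy0 : x0 <> y0).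
Variable tau : C -> I * C.
Hypothesis tauP : forall x, A x -> A (tau x).2 /\ x = g (tau x).1 (tau x).2.

Let A2 : exists x y, [/\ A x, A y & x <> y].
Proof. by exists x0, y0. Qed.

Let sG := scale g x0 y0.
Let sF := scale f x0 y0.
Let B := cs_B K th C1 D.
Let B' := cs_B K' th' C1' D'.

(* [h] is the piece [f_v A] seen from the smallest piece of [g] around [beta]
   containing it; the two pieces have comparable sizes. *)
Lemma pullback : exists E : R, 0 < E /\ forall (beta x : C), A beta -> A x ->
  (forall n, exists2 v : seq J, (n <= size v)%N & wmap f v x = beta) ->
  forall p, exists m v h, [/\ (p <= m)%N, wmap f v x = beta,
    forall z, A z -> A (h z) /\ wmap g (code tau m beta) (h z) = wmap f v z,
    sG (code tau m beta) <= E * sF v & sF v <= E * sG (code tau m beta)].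
Proof.
have B0 : 0 < B := cs_B_gt0 K th C1 D.
have B'0 : 0 < B' := cs_B_gt0 K' th' C1' D'.
have D0 : 0 < D := cs_D S.
have kap0 := cs_kappa_gt0 S; set kap := cs_kappa K th C1 sg D in kap0.
have [c2 c20 hc2] := scale_rcons S Ax0 Ay0 xy0.
have iso := isolation S Ax0 Ay0 xy0; rewrite -/kap -/sG in iso.
clearbody kap.
have sG0 w : 0 < sG w := scale_gt0 S Ax0 Ay0 xy0 w.
have sF0 w : 0 < sF w := scale_gt0 S' Ax0 Ay0 xy0 w.
have n0 : 0 < nm (x0 - y0) := nmB_gt0 xy0.
pose E1 := c2 * B' * D / kap; pose E2 := B * D / nm (x0 - y0).
have E10 : 0 < E1 by rewrite divr_gt0 ?mulr_gt0.
have E20 : 0 < E2 by rewrite divr_gt0 ?mulr_gt0.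
exists (E1 + E2); split; first exact: addr_gt0.
move=> beta x Ab Ax vn p.
pose w n := code tau n beta.
pose inw v n := forall z, A z -> exists2 z1, A z1 & wmap f v z = wmap g (w n) z1.
have wb n : beta = wmap g (w n) (tail tau n beta) by rewrite (code_tail tauP).
have Atl n : A (tail tau n beta) by exact: (tail_into tauP).
(* For a long word [v] the set [wmap f v A] is narrower than the isolation of the piece of rank [p],
   and both contain [beta]. *)
have [v vb inp] : exists2 v, wmap f v x = beta & inw v p.
  have e0 : 0 < kap * sG (w p) by rewrite mulr_gt0.
  have [n hn] := th_pow_small S' e0; have [v nv vb] := vn n; exists v => // z Az.
  apply: contrapT => npc.
  have Afz : A (wmap f v z) by exact: (wmap_into S').
  have := iso (w p) _ _ (Atl p) Afz npc; rewrite -wb -vb.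
  apply/negP; rewrite -ltNge.
  by apply: le_lt_trans (wmap_dist S' v Ax Az) _; exact: hn.
have ex : exists n, (p < n)%N && ~~ `[< inw v n >].
  have e0 : 0 < nm (wmap f v x0 - wmap f v y0).
    by apply: nmB_gt0; exact: (wmap_neq S').
  have [n hn] := th_pow_small S e0; exists (maxn p.+1 n).
  rewrite leq_maxl; apply/asboolPn => /[dup] /(_ x0 Ax0)[x1 Ax1 e1] /(_ y0 Ay0)[y1 Ay1 e2].
  have := wmap_dist S (w (maxn p.+1 n)) Ax1 Ay1; rewrite -e1 -e2.
  by apply/negP; rewrite -ltNge size_code; apply: hn; rewrite leq_maxr.
(* [m.+1] is the first level past [p] that fails, so [p <= m] and the piece of rank [m] still
   contains [wmap f v A]. *)
case: (ex_minnP ex) => -[//|m] /andP[pm /asboolPn nin] mmin.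
have inm : inw v m.
  have [->//|pm'] := eqVneq m p.
  apply: contrapT => nm_; have : (m < m)%N; last by rewrite ltnn.
  by apply: mmin; rewrite ltn_neqAle eq_sym pm' -ltnS pm; apply/asboolPn.
have /choice[h hP] : forall z, exists z1, A z -> A z1 /\ wmap g (w m) z1 = wmap f v z.
  move=> z; have [Az|nAz] := pselect (A z); last by exists z.
  by have [z1 Az1 e1] := inm z Az; exists z1.
exists m, v, h; split => //.
  (* Some point of [wmap f v A] lies outside the next piece; by [isolation] the scale of that piece,
     and hence of its parent, is bounded by the size of [wmap f v A]. *)
  have [y Ay ny] : exists2 y, A y & ~ (exists2 z1, A z1 & wmap f v y = wmap g (w m.+1) z1).
    apply: contrapT => H; apply: nin => z Az; apply: contrapT => nz.
    by apply: H; exists z.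
  have Afy : A (wmap f v y) by exact: (wmap_into S').
  have h1 := iso (w m.+1) _ _ (Atl m.+1) Afy ny.
  rewrite -wb -vb in h1.
  have h2 := dist_le_scale S' Ax0 Ay0 xy0 v Ax Ay; rewrite -/sF -/B' in h2.
  have h3 : B' * sF v * nm (x - y) <= B' * sF v * D.
    by rewrite ler_wpM2l ?(cs_diam S)// mulr_ge0// ltW.
  have h4 : sG (w m) <= c2 * sG (w m.+1) by rewrite /w code_rcons hc2.
  have h5 : sG (w m.+1) <= B' * sF v * D / kap.
    by rewrite ler_pdivlMr// mulrC; apply: le_trans h1 (le_trans h2 h3).
  apply: le_trans h4 _; apply: (@le_trans _ _ (E1 * sF v)).
    rewrite (_ : E1 * sF v = c2 * (B' * sF v * D / kap)); first by rewrite ler_pM2l.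
    by rewrite /E1; ring.
  by rewrite ler_wpM2r ?ltW// ltrDl.
apply: (@le_trans _ _ (E2 * sG (w m))); last by rewrite ler_wpM2r ?ltW// ltrDr.
have [Ah0 e1] := hP x0 Ax0; have [Ah1 e2] := hP y0 Ay0.
rewrite /E2 mulrAC ler_pdivlMr// {1}/sF /scale (nm_quot _ xy0) -e1 -e2.
apply: le_trans (dist_le_scale S Ax0 Ay0 xy0 (w m) Ah0 Ah1) _.
rewrite mulrAC -/sG -/B; apply: ler_wpM2r; first exact: ltW.
by rewrite ler_pM2l// (cs_diam S).
Qed.

(** The estimates for [wmap f v] and [wmap g w] are relative to their scales, which cancel in [h];
    so the constants depend on [E] but not on the words. The last clause is the isolation of the
    piece of [f] seen through [wmap g w], and it later provides the hypothesis of [rigidity] that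
    [k] takes its values in [h A]. *)
Lemma pullback_regular (E : R) : 0 < E -> exists b c k : R, [/\ 0 < b, 0 < c, 0 < k &
  forall (w : seq I) (v : seq J) (h : C -> C),
    (forall z, A z -> A (h z) /\ wmap g w (h z) = wmap f v z) ->
    sG w <= E * sF v -> sF v <= E * sG w ->
    [/\ forall x y, A x -> A y -> nm (x - y) <= b * nm (h x - h y),
      forall x y, A x -> A y -> nm (h x - h y) <= b * nm (x - y),
      quasi_affine A c h &
      forall x y, A x -> A y -> nm (y - h x) < k -> exists2 z, A z & y = h z]].
Proof.
move=> E0.
have B0 : 0 < B := cs_B_gt0 K th C1 D.
have B'0 : 0 < B' := cs_B_gt0 K' th' C1' D'.
have C30 := cs_C3_gt0 S; have C30' := cs_C3_gt0 S'.
set C3 := cs_C3 K th C1 D in C30; set C3' := cs_C3 K' th' C1' D' in C30'.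
have kap0 := cs_kappa_gt0 S'; set kap := cs_kappa K' th' C1' sg' D' in kap0.
pose b := B * B' * E; pose c := b * (C3' + C3 * b); pose k := kap / (B * E).
have b0 : 0 < b by rewrite !mulr_gt0.
have c0 : 0 < c by rewrite mulr_gt0// addr_gt0// mulr_gt0.
have k0 : 0 < k by rewrite divr_gt0// mulr_gt0.
exists b, c, k; split => // w v h hP st ts.
have s0 : 0 < sG w := scale_gt0 S Ax0 Ay0 xy0 w.
have t0 : 0 < sF v := scale_gt0 S' Ax0 Ay0 xy0 v.
have hup x y : A x -> A y -> nm (h x - h y) <= b * nm (x - y).
  move=> Ax Ay; have [Ahx ex] := hP x Ax; have [Ahy ey] := hP y Ay.
  have h1 := scale_le_dist S Ax0 Ay0 xy0 w Ahx Ahy; rewrite -/sG -/B ex ey in h1.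
  have h2 := dist_le_scale S' Ax0 Ay0 xy0 v Ax Ay; rewrite -/sF -/B' in h2.
  rewrite -(ler_pM2l s0); apply: le_trans h1 _.
  apply: (@le_trans _ _ (B * (B' * sF v * nm (x - y)))); first by rewrite ler_pM2l.
  rewrite (_ : sG w * _ = (B * B' * nm (x - y)) * (E * sG w)); last by rewrite /b; ring.
  rewrite (_ : B * _ = (B * B' * nm (x - y)) * sF v); last by ring.
  by rewrite ler_wpM2l// mulr_ge0 ?nm_ge0// mulr_ge0// ltW.
have hlow x y : A x -> A y -> nm (x - y) <= b * nm (h x - h y).
  move=> Ax Ay; have [Ahx ex] := hP x Ax; have [Ahy ey] := hP y Ay.
  have h1 := scale_le_dist S' Ax0 Ay0 xy0 v Ax Ay; rewrite -/sF -/B' -ex -ey in h1.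
  have h2 := dist_le_scale S Ax0 Ay0 xy0 w Ahx Ahy; rewrite -/sG -/B in h2.
  rewrite -(ler_pM2l t0); apply: le_trans h1 _.
  apply: (@le_trans _ _ (B' * (B * sG w * nm (h x - h y)))); first by rewrite ler_pM2l.
  rewrite (_ : sF v * _ = (B * B' * nm (h x - h y)) * (E * sF v)); last by rewrite /b; ring.
  rewrite (_ : B' * _ = (B * B' * nm (h x - h y)) * sG w); last by ring.
  by rewrite ler_wpM2l// mulr_ge0 ?nm_ge0// mulr_ge0// ltW.
have hinj x y : A x -> A y -> x <> y -> h x <> h y.
  move=> Ax Ay xy hxy; apply: xy; apply: nmB_eq0; apply: le_trans (hlow x y Ax Ay) _.
  by rewrite hxy subrr nm0 mulr0.
split => //; last first.
  move=> x y Ax Ay yx; have [Ahx ex] := hP x Ax.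
  apply: contrapT => ny.
  have Agy : A (wmap g w y) by exact: (wmap_into S).
  have npc : ~ exists2 z, A z & wmap g w y = wmap f v z.
    move=> [z Az e1]; apply: ny; exists z => //; have [Ahz ez] := hP z Az.
    by apply: (wmap_inj S Ay Ahz (w := w)); rewrite ez.
  have h1 := isolation S' Ax0 Ay0 xy0 Ax Agy npc; rewrite -/kap -/sF -ex in h1.
  have h2 := dist_le_scale S Ax0 Ay0 xy0 w Ahx Ay; rewrite -/sG -/B nmBC (nmBC (h x)) in h2.
  rewrite nmBC in h1; have := le_trans h1 h2; apply/negP; rewrite -ltNge.
  apply: (@lt_le_trans _ _ (B * sG w * k)); first by rewrite ltr_pM2l// mulr_gt0.
  rewrite (_ : B * sG w * k = kap / E * sG w); last by rewrite /k; field; rewrite !gt_eqF.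
  have sE : sG w / E <= sF v by rewrite ler_pdivrMr// mulrC.
  by have := ler_wpM2l (ltW kap0) sE; rewrite (mulrA kap) (mulrAC kap).
move=> d x y x' y' Ax Ay Ax' Ay' xy xy' h1 h2 h3.
have d0 : 0 <= d by apply: le_trans h1; exact: nm_ge0.
have qE u z : A u -> A z -> u <> z ->
    quot (wmap f v) u z = quot (wmap g w) (h u) (h z) * quot h u z.
  move=> Au Az uz; have [_ eu] := hP u Au; have [_ ez] := hP z Az.
  by rewrite -quot_comp; [rewrite /quot eu ez|exact: hinj].
have [Ahx _] := hP x Ax; have [Ahy _] := hP y Ay.
have [Ahx' _] := hP x' Ax'; have [Ahy' _] := hP y' Ay'.
have hxy := hinj _ _ Ax Ay xy; have hxy' := hinj _ _ Ax' Ay' xy'.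
have bd u z : A u -> A z -> nm (u - z) <= d -> nm (h u - h z) <= b * d.
  by move=> Au Az uz; apply: le_trans (hup u z Au Az) _; rewrite ler_pM2l.
have F1 := word_quot_dist S' v Ax Ay Ax' Ay' xy xy' h1 h2 h3.
have G1 := word_quot_dist S w Ahx Ahy Ahx' Ahy' hxy hxy'
  (bd _ _ Ay Ax h1) (bd _ _ Ax' Ax h2) (bd _ _ Ay' Ax h3).
have a0 := quot_gt0 S w Ahx Ahy hxy; have a0' := quot_gt0 S w Ahx' Ahy' hxy'.
have Fs := distortion S' v Ax' Ay' Ax0 Ay0 xy' xy0.
have Gs := distortion S w Ax0 Ay0 Ahx Ahy xy0 hxy.
rewrite -/C3 -/C3' -/B -/B' -/(sF v) -/(sG w) in F1 G1 Fs Gs.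
have q1 := qE _ _ Ax Ay xy; have q2 := qE _ _ Ax' Ay' xy'.
move: F1 G1 a0 a0' Fs Gs q1 q2.
move: (quot (wmap f v) x y) (quot (wmap f v) x' y') (quot (wmap g w) _ _)
  (quot (wmap g w) _ _) (quot h x y) (quot h x' y') => F F' a' a q q'.
move=> F1 G1 a0 a0' Fs Gs q1 q2.
have [an0 an0'] : a != 0 /\ a' != 0 by rewrite -!nm_gt0.
have -> : q - q' = ((F - F') - q' * (a - a')) / a by rewrite q1 q2; field.
rewrite nm_div ler_pdivrMr//; apply: le_trans (nmD _ _) _; rewrite nmN nmM.
have ratio : nm F' <= b * nm a.
  apply: le_trans Fs _; apply: (@le_trans _ _ (B' * (E * sG w))); first by rewrite ler_pM2l.
  rewrite (_ : b * nm a = B' * (E * (B * nm a))); last by rewrite /b; ring.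
  by rewrite !ler_pM2l.
have e1 : nm (F - F') <= C3' * d * (b * nm a).
  by apply: le_trans F1 _; rewrite ler_wpM2l// mulr_ge0// ltW.
have e2 : nm q' * nm (a - a') <= C3 * (b * d) * (b * nm a).
  apply: (@le_trans _ _ (nm q' * (C3 * (b * d) * nm a'))).
    by rewrite ler_wpM2l ?nm_ge0.
  rewrite (_ : nm q' * _ = C3 * (b * d) * nm F'); last by rewrite q2 nmM; ring.
  apply: ler_wpM2l => //; apply: mulr_ge0; first exact: ltW.
  by apply: mulr_ge0 => //; exact: ltW.
by rewrite /c; apply: le_trans (lerD e1 e2) _; rewrite le_eqVlt; apply/orP; left; apply/eqP; ring.
Qed.

Lemma orbit_meets_tail (beta x : C) : A beta -> A x ->
  (forall n, exists2 v : seq J, (n <= size v)%N & wmap f v x = beta) ->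
  exists m m', (m < m')%N /\ tail tau m beta = tail tau m' beta.
Proof.
move=> Ab Ax vn; have [E [E0 pb]] := pullback.
have [b [c [k [b0 c0 k0 reg]]]] := pullback_regular E0.
have [d1 d10 rig] := rigidity S A2 b0.
(* Below [d1] for [rigidity], and below [k] so that each value of one map is in the image of the
   other. *)
pose d := Num.min d1 (k / 2); have d0 : 0 < d by rewrite lt_min d10 divr_gt0.
have [s [e e0 [sA close]]] := close_on_net S A2 c0 d0.
have A0 : A !=set0 by exists x0.
have e20 : 0 < e / 2 by rewrite divr_gt0.
have [N [NA Nnet]] := finite_net S A0 e20.
have /choice[idx idxP] : forall z, exists i : 'I_(size N).+1, A z ->
    nm (z - nth 0 N i) <= e / 2.
  move=> z; have [Az|nAz] := pselect (A z); last by exists ord0.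
  have [a aN za] := Nnet z Az; have aN' := aN; rewrite -index_mem in aN'.
  by exists (Ordinal (leqW aN')) => _ /=; rewrite nth_index.
have /choice[F FP] : forall p, exists mh : nat * (C -> C), [/\ (p <= mh.1)%N,
    mh.2 x = tail tau mh.1 beta, forall z, A z -> A (mh.2 z),
    (forall x y, A x -> A y -> nm (x - y) <= b * nm (mh.2 x - mh.2 y)) /\
    (forall x y, A x -> A y -> nm (mh.2 x - mh.2 y) <= b * nm (x - y)) &
    quasi_affine A c mh.2 /\
    forall x y, A x -> A y -> nm (y - mh.2 x) < k -> exists2 z, A z & y = mh.2 z].
  move=> p; have [m [v [h [pm vb hP st ts]]]] := pb beta x Ab Ax vn p.
  have [r1 r2 r3 r4] := reg _ _ _ hP st ts.
  exists (m, h); split => //; last by move=> z /hP[].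
  have [Ahx hx] := hP x Ax.
  apply: (wmap_inj S Ahx (tail_into tauP m Ab) (w := code tau m beta)).
  by rewrite hx vb (code_tail tauP).
(* Rounds the values of the [p]-th map on [s] to points of [N]; maps with equal cells differ by at
   most [e] on [s]. *)
pose cell p : {ffun 'I_(size s) -> 'I_(size N).+1} := [ffun i : 'I_(size s) => idx ((F p).2 (nth 0 s (nat_of_ord i)))].
have [p [q [pq mpq]]] := @infinite_pigeonhole _ cell (fun p => (F p).1) (fun p =>
  let: And5 h _ _ _ _ := FP p in h).
exists (F p).1, (F q).1; split => //.
have [_ hp Ap [lp up] [qp ip]] := FP p; have [_ hq Aq [lq uq] [qq iq]] := FP q.
have [|supd lipd] := close (F p).2 (F q).2 qp qq.
  move=> a sa; have := sa; rewrite -index_mem => ia.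
  have := congr1 (fun t : {ffun _ -> _} => t (Ordinal ia)) pq; rewrite !ffunE /= nth_index// => ij.
  have h1 := idxP _ (Ap a (sA a sa)); have h2 := idxP _ (Aq a (sA a sa)).
  rewrite -ij in h2; rewrite nmBC in h1.
  by apply: le_trans (nmB_trans _ _ _) _; rewrite (splitr e); exact: lerD h2 h1.
rewrite -hp -hq; apply/esym; apply: (rig (F p).2 (F q).2) => //.
- move=> z Az; apply: (ip z) => //; first exact: Aq.
  apply: (@le_lt_trans _ _ (k / 2)); last by rewrite ltr_pdivrMr// ltr_pMr// ltr1n.
  by apply: le_trans (supd z Az) _; rewrite ge_min lexx orbT.
- by move=> z Az; apply: le_trans (supd z Az) _; rewrite ge_min lexx.
- move=> y z Ay Az; apply: le_trans (lipd y z Ay Az) _.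
  by rewrite ler_wpM2r ?nm_ge0// ge_min lexx.
Qed.

End Comparison.

(** * Preperiodic points *)

Section PeriodicPoints.
Variables (R : realType) (G : holomorphic_ifs R) (A : set (plane R)).
Hypothesis attr : is_attractor G A.
Local Notation C := (R[i]).
Local Notation g := (@ifs_map R G).
Implicit Types (x y : C) (w : seq (ifs_index G)).

(** By compactness a map without fixed point would move all points of [A] by at least some
    [n.+1%:R^-1], while displacements along an orbit decay like [q ^+ k]. *)
Lemma contracting_fixed_point (f : C -> C) (q : R) : A !=set0 -> compact A -> 0 <= q < 1 ->
  (forall x, A x -> A (f x)) ->
  (forall x y, A x -> A y -> nm (f x - f y) <= q * nm (x - y)) ->
  exists2 z, A z & f z = z.
Proof.
move=> [x0 Ax0] cA /andP[q0 q1] fA fq; apply: contrapT => nofix.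
have [|a Aa|n hn] := @compact_uniform R A (fun n y => n.+1%:R^-1 <= nm (f y - y)) cA.
- move=> n m x nm'; apply: le_trans.
  by rewrite lef_pV2 ?posrE ?ltr0Sn// ler_nat ltnS.
- have v0 : 0 < nm (f a - a) by apply: nmB_gt0 => fa; apply: nofix; exists a.
  have v20 : 0 < nm (f a - a) / 2 by rewrite divr_gt0.
  have [n hn] := exists_natr_inv v20.
  exists n; exists (nm (f a - a) / 4); first by rewrite divr_gt0.
  move=> y Ay ya; apply: le_trans hn _.
  have h1 : nm (f y - f a) <= nm (y - a).
    by apply: le_trans (fq y a Ay Aa) _; rewrite ler_piMl ?nm_ge0// ltW.
  have h2 := nm_leB (f a - a) (f y - y).
  rewrite (_ : f a - a - _ = (y - a) - (f y - f a)) in h2; last by ring.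
  have h3 := nmD (y - a) (- (f y - f a)); rewrite nmN in h3; lra.
pose z n := iter n f x0.
have Az k : A (z k) by elim: k => //= k; exact: fA.
have step k : nm (z k.+1 - z k) <= q ^+ k * nm (f x0 - x0).
  elim: k => [|k IH]; first by rewrite expr0 mul1r.
  apply: le_trans (fq _ _ (Az k.+1) (Az k)) _.
  by rewrite exprS -mulrA ler_wpM2l.
have : q ^+ n @[n --> \oo] --> (0 : R) by apply: cvg_expr; rewrite ger0_norm.
have e0 : 0 < n.+1%:R^-1 / (nm (f x0 - x0) + 1).
  by rewrite divr_gt0 ?invr_gt0 ?ltr0Sn// ltr_wpDl// nm_ge0.
move/cvgrPdist_lt => /(_ _ e0)[k _ /(_ k (leqnn k))] /=.
rewrite sub0r normrN ger0_norm ?exprn_ge0// ltr_pdivlMr; last by rewrite ltr_wpDl// nm_ge0.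
move=> hk; have := le_trans (hn _ (Az k)) (step k); apply/negP; rewrite -ltNge.
apply: le_lt_trans hk; rewrite ler_wpM2l ?exprn_ge0// lerDl//.
Qed.

Lemma word_map_repeat n w x : word_map w x = x -> word_map (flatten (nseq n w)) x = x.
Proof.
by move=> wx; elim: n => //= n IH; rewrite word_map_cat IH.
Qed.

Lemma size_repeat n w : w != [::] -> (n <= size (flatten (nseq n w)))%N.
Proof.
move=> w0; elim: n => //= n IH; rewrite size_cat -add1n leq_add//.
by rewrite lt0n size_eq0.
Qed.

(** [b] is fixed by the powers of [w], under which its images and those of a point of [A] come
    together; and [A] is closed. *)
Lemma Per_attr b : Per G b -> A b.
Proof.
move=> [Ob [w w0 wb]]; have [cA AO] : compact A /\ A `<=` ifs_dom G by case: attr.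
have [x Ax] : A !=set0 by case: attr.
have [th /andP[th0 th1] [_ _ [_ OC]]] := attr_contraction attr.
have [K hK] := OC x b (AO x Ax) Ob.
apply: (compact_closedP cA) => d d0.
have K1 : 0 < `|K| + 1 by rewrite ltr_wpDl.
have : th ^+ n @[n --> \oo] --> (0 : R) by apply: cvg_expr; rewrite gtr0_norm.
move/cvgrPdist_lt => /(_ _ (divr_gt0 d0 K1))[n _ hn].
exists (word_map (flatten (nseq n w)) x); first exact: attr_word.
rewrite nmBC -{1}(word_map_repeat n wb); apply: le_lt_trans (hK _) _.
have := hn (size (flatten (nseq n w))) (size_repeat n w0).
rewrite /= sub0r normrN gtr0_norm ?exprn_gt0// ltr_pdivlMr// mulrC.
apply: le_lt_trans; rewrite ler_wpM2r ?exprn_ge0 ?ltW//.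
by apply: le_lt_trans (ler_norm K) _; rewrite ltrDl.
Qed.

Lemma Prep_attr b : Prep G b -> A b.
Proof.
move=> [/Per_attr//|[w [x [_ /Per_attr Ax ->]]]]; exact: attr_word.
Qed.

Lemma Prep_many_words b : Prep G b -> exists2 x, A x &
  forall n, exists2 w : seq (ifs_index G), (n <= size w)%N & word_map w x = b.
Proof.
move=> [Pb|[w [x [w0 Px ->]]]].
  exists b; first exact: Per_attr.
  case: Pb => _ [w w0 wb] n; exists (flatten (nseq n w)); first exact: size_repeat.
  exact: word_map_repeat.
exists x; first exact: Per_attr.
case: Px => _ [u u0 ux] n; exists (w ++ flatten (nseq n u)).
  by rewrite size_cat; apply: leq_trans (size_repeat n u0) _; rewrite leq_addl.
by rewrite word_map_cat word_map_repeat.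
Qed.

(** A sufficiently small piece around [a] contains the fixed point of its own word. *)
Lemma Per_dense : strong_separation G A -> forall a (d : R), A a -> 0 < d ->
  exists2 b, Per G b & nm (b - a) < d.
Proof.
move=> ssc a d Aa d0; have [cA AO] : compact A /\ A `<=` ifs_dom G by case: attr.
have [K [th [C1 [sg [D S]]]]] := attr_conf_sys attr ssc.
have A0 : A !=set0 by case: attr.
have [tau tauP] := itinerary_exists S A0.
have D0 := cs_D S; have /andP[th0 th1] := cs_th S; have K0 := cs_K S.
(* Below [d] for the distance to [a], and below [D] so that [K * th ^+ n.+1 < 1] and the word
   contracts. *)
have e0 : 0 < Num.min d D by rewrite lt_min d0.
have [n hn] := th_pow_small S e0.
pose w := code tau n.+1 a.
have := hn n.+1 (leqnSn n); rewrite lt_min => /andP[wd wD].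
have kq : 0 <= K * th ^+ n.+1 < 1.
  by rewrite mulr_ge0 ?exprn_ge0 ?ltW//= -(ltr_pM2r D0) mul1r.
have [||b Ab wb] := @contracting_fixed_point (wmap g w) _ A0 cA kq.
- by move=> x; exact: (wmap_into S).
- move=> x y Ax Ay; have := cs_contr S w Ax Ay.
  by rewrite size_code.
exists b; first by split; [exact: AO|exists w].
rewrite -wb -[X in _ - X](code_tail tauP n.+1 Aa).
apply: le_lt_trans (wmap_dist S w Ab (tail_into tauP n.+1 Aa)) _.
by rewrite size_code.
Qed.

Lemma tail_repeat_Prep (tau : C -> ifs_index G * C) b m m' :
  (forall x, A x -> A (tau x).2 /\ x = g (tau x).1 (tau x).2) ->
  A b -> (m < m')%N -> tail tau m b = tail tau m' b -> Prep G b.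
Proof.
move=> tauP Ab mm' tmm; have AO : A `<=` ifs_dom G by case: attr.
have Ax := tail_into tauP m Ab.
have Px : Per G (tail tau m b).
  split; first exact: AO.
  exists (code tau (m' - m) (tail tau m b)).
    by rewrite -size_eq0 size_code subn_eq0 -ltnNge.
  rewrite -[RHS](code_tail tauP (m' - m) Ax); congr (word_map _ _).
  by rewrite {2}/tail -iterD subnK ?(ltnW mm')// -/(tail tau m' b).
(* For [m = 0] the prefix would be the empty word, which [Prep] excludes; then [b] itself is
   periodic. *)
case: m {mm' tmm} Ax Px => [|m] Ax Px; first by left.
right; exists (code tau m.+1 b), (tail tau m.+1 b); split => //.
by apply/esym; exact: (code_tail tauP m.+1 Ab).
Qed.

End PeriodicPoints.

(** * Inclusions between preperiodic sets and between attractors *)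

Lemma Prep_sub (R : realType) (G F : holomorphic_ifs R) (A : set (plane R)) :
  is_attractor G A -> is_attractor F A ->
  (exists x y : plane R, [/\ A x, A y & x <> y]) ->
  strong_separation G A -> strong_separation F A -> Prep F `<=` Prep G.
Proof.
move=> attrG attrF [x0 [y0 [Ax0 Ay0 xy0]]] sscG sscF b Pb.
have Ab := Prep_attr attrF Pb.
have [K [th [C1 [sg [D S]]]]] := attr_conf_sys attrG sscG.
have [K' [th' [C1' [sg' [D' S']]]]] := attr_conf_sys attrF sscF.
have A0 : A !=set0 by case: attrG.
have [tau tauP] := itinerary_exists S A0.
have [x Ax xb] := Prep_many_words attrF Pb.
have [m [m' [mm' tmm]]] := orbit_meets_tail S S' Ax0 Ay0 xy0 tauP Ab Ax xb.
exact: (tail_repeat_Prep attrG tauP Ab mm' tmm).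
Qed.

Lemma attr_sub (R : realType) (G F : holomorphic_ifs R) (AG AF : set (plane R)) :
  is_attractor G AG -> is_attractor F AF -> strong_separation G AG ->
  Prep G `<=` Prep F -> AG `<=` AF.
Proof.
move=> attrG attrF sscG PGF a Aa.
have cA : compact AF by case: attrF.
apply: (compact_closedP cA) => d d0.
have [b Pb bd] := Per_dense attrG sscG Aa d0.
by exists b => //; apply: (Prep_attr attrF); apply: PGF; left.
Qed.

Theorem corollary3p10 (R : realType) (G F : holomorphic_ifs R)
  (AG AF : set (plane R))
  (attrG : is_attractor G AG) (attrF : is_attractor F AF)
  (AG_ge2 : exists x y : plane R, [/\ AG x, AG y & x <> y])
  (AF_ge2 : exists x y : plane R, [/\ AF x, AF y & x <> y])
  (sscG : strong_separation G AG) (sscF : strong_separation F AF) :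
  AG = AF <-> Prep G = Prep F.
Proof.
split=> [AGF|PGF].
  rewrite -AGF in attrF sscF.
  apply/seteqP; split.
    exact: (Prep_sub attrF attrG AG_ge2 sscF sscG).
  exact: (Prep_sub attrG attrF AG_ge2 sscG sscF).
apply/seteqP; split.
  by apply: (attr_sub attrG attrF sscG); rewrite PGF.
by apply: (attr_sub attrF attrG sscF); rewrite PGF.
Qed.
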